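(* If $K$ is a Corson compact space with $w(K)\ge\mathfrak c$, then $\operatorname{Ext}\big(C(K),c_0\big)\ne0$. In particular, under the continuum hypothesis, $\operatorname{Ext}\big(C(K),c_0\big)\ne0$ for any nonmetrizable Corson compact space $K$.
   Context: $w(K)$ denotes the weight of $K$ (the least cardinality of a base) and $\mathfrak c$ the cardinality of the continuum. $C(K)$ is the Banach space of continuous real-valued functions on $K$ with the supremum norm. For an index set $I$, $\Sigma(I)=\{x\in\mathbb R^I:\operatorname{supp}x\text{ is countable}\}$, where $\operatorname{supp}x=\{i\in I:x_i\ne0\}$. A compact Hausdorff space $K$ is a Corson compactum if there exist an index set $I$ and a continuous injection $\varphi:K\to\mathbb R^I$ with $\varphi[K]\subset\Sigma(I)$. A twisted sum of Banach spaces $Y$ and $X$ is a short exact sequence $0\to Y\to Z\to X\to0$ with $Z$ a Banach space and the maps bounded linear operators; it is trivial if $Y\to Z$ admits a bounded linear left inverse. $\operatorname{Ext}(X,Y)\ne0$ means that some such twisted sum is nontrivial. *)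

(* Defs.v *)
From HB Require Import structures.
From mathcomp Require Import all_boot all_order all_algebra.
From mathcomp Require Import all_classical all_reals all_analysis.
From mathcomp Require Import ring.

Set Implicit Arguments.
Unset Strict Implicit.
Unset Printing Implicit Defensive.

Import Order.TTheory GRing.Theory Num.Theory.
Import numFieldNormedType.Exports.

Local Open Scope classical_set_scope.
Local Open Scope ring_scope.
Local Open Scope card_scope.

(** The library has no type of cardinal numbers: a cardinal is represented by a
    set having that cardinality, and cardinals are compared with [#<=].  In
    particular [[set: R]] stands for the cardinality of the continuum. *)

Definition least_base (T : topologicalType) : set (set (set T)) :=
  [set B | basis B /\ forall B' : set (set T), basis B' -> B #<= B'].

Definition weight (T : topologicalType) : set (set T) :=
  xget set0 (@least_base T).
Arguments weight T : clear implicits.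

Lemma exists_card_min (U : Type) (P : set (set U)) : P !=set0 ->
  exists2 B, P B & forall B', P B' -> B #<= B'.
Proof.
move=> [B0 PB0].
have [P0|nP0] := pselect (P set0).
  by exists set0 => // B' _; exact: card_ge0.
have [x0 _] : B0 !=set0 by apply/set0P/eqP => B00; apply: nP0; rewrite -B00.
pose good (S : set (set U -> U)) :=
  (forall f, S f -> forall B, P B -> B (f B)) /\
  (forall f g, S f -> S g -> forall B, P B -> f B = g B -> f = g).
have [S [[Sin Sinj] Smax]] : exists S, good S /\ forall S', S `<` S' -> ~ good S'.
  apply: (@Zorn_bigcup _ good) => F Fgood Ftot; split.
    by move=> f [X FX Xf] B PB; have [Xin _] := Fgood _ FX; exact: (Xin f Xf B PB).
  move=> f g [X FX Xf] [Y FY Yg] B PB.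
  have [XY|YX] := Ftot _ _ FX FY.
  - by have [_ Yinj] := Fgood _ FY; apply: Yinj PB => //; exact: XY.
  - by have [_ Xinj] := Fgood _ FX; apply: Xinj PB => //; exact: YX.
have [[B [PB surjB]]|noB] := pselect (exists B, P B /\
    forall b, B b -> exists2 f, S f & f B = b).
  exists B => // B' PB'.
  have [b0 Bb0] : B !=set0 by apply/set0P/eqP => B0'; apply: nP0; rewrite -B0'.
  have [f0 Sf0 _] := surjB _ Bb0.
  have /choice[h hP] : forall b, exists f, B b -> S f /\ f B = b.
    move=> b; have [Bb|nBb] := pselect (B b); last by exists f0.
    by have [f Sf fb] := surjB _ Bb; exists f.
  pose g b := h b B'.
  have ginj : {in B &, injective g}.
    move=> b c; rewrite !inE => Bb Bc gbc.
    have [Sb <-] := hP _ Bb; have [Sc <-] := hP _ Bc.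
    by rewrite (Sinj _ _ Sb Sc B' PB' gbc).
  have /card_esym := inj_card_eq ginj; rewrite card_eq_le => /andP[Bg _].
  apply: card_le_trans Bg _; apply: subset_card_le => _ [b Bb <-].
  by have [Sb _] := hP _ Bb; exact: (Sin _ Sb _ PB').
exfalso.
have /choice[f fP] : forall B, exists b, P B ->
    B b /\ forall f, S f -> f B <> b.
  move=> B; have [PB|nPB] := pselect (P B); last by exists x0.
  apply: contrapT => nb; apply: noB; exists B; split => // b Bb.
  apply: contrapT => nf; apply: nb; exists b => _; split => // f Sf fb.
  by apply: nf; exists f.
have fS : ~ S f by move=> Sf; have [_ /(_ f Sf)] := fP _ PB0.
apply: (Smax (S `|` [set f])).
  split; first exact: subsetUl.
  by move=> /(_ f) fSf; apply: fS; apply: fSf; right.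
split=> [g [Sg|->] B PB|g k]; [exact: (Sin _ Sg _ PB)|by have [] := fP _ PB|].
move=> [Sg|->] [Sk|->] B PB gk //; first exact: (Sinj _ _ Sg Sk B).
  by have [_ /(_ _ Sg)] := fP _ PB.
by have [_ /(_ _ Sk)] := fP _ PB; rewrite gk.
Qed.

Lemma weightP (T : topologicalType) :
  basis (weight T) /\ forall B : set (set T), basis B -> weight T #<= B.
Proof.
have [B bB minB] : exists2 B : set (set T), basis B &
    forall B' : set (set T), basis B' -> B #<= B'.
  apply: (@exists_card_min (set T) (@basis T)); exists open; split => // x A.
  by rewrite nbhsE => -[V [oV Vx] VA]; exists V.
by rewrite /weight; case: xgetP => [_ _ //|/(_ B)]; case.
Qed.

Definition metrizable (R : realType) (T : topologicalType) : Prop :=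
  exists (M : metricType R) (f : T -> M) (g : M -> T),
    [/\ cancel f g, cancel g f, continuous f & continuous g].

Definition Sigma_product (R : realType) (I : Type) : set (I -> R) :=
  [set x | countable [set i | x i != 0]].
Arguments Sigma_product R I : clear implicits.

Definition Corson_compact (R : realType) (K : topologicalType) : Prop :=
  [/\ compact [set: K], hausdorff_space K &
    exists (I : Type) (phi : K -> {ptws I -> R}),
      [/\ continuous phi, injective phi & range phi `<=` Sigma_product R I]].

Definition continuum_hypothesis (R : realType) : Prop :=
  forall A : set R, countable A \/ A #= [set: R].

Section sup_norm.
Context {R : realType} {T : Type}.
Implicit Types f g : T -> R.

Definition sup_norm f : R := sup (range (fun x => `|f x|)).

Lemma sup_norm_ub f x : has_ubound (range (fun x => `|f x|)) ->
  `|f x| <= sup_norm f.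
Proof. by move=> fb; apply: ub_le_sup => //; exists x. Qed.

Lemma sup_norm_ge0 f : 0 <= sup_norm f.
Proof.
have [fb|fb] := pselect (has_ubound (range (fun x => `|f x|))); last first.
  by rewrite /sup_norm sup_out// => -[].
have [[x _]|T0] := pselect ([set: T] !=set0).
  by apply: le_trans (sup_norm_ub x fb).
by rewrite /sup_norm sup_out// => -[[_ [x _ _]] _]; apply: T0; exists x.
Qed.

Lemma sup_norm_le f M : 0 <= M -> (forall x, `|f x| <= M) -> sup_norm f <= M.
Proof.
move=> M0 fM; have [[x _]|T0] := pselect ([set: T] !=set0).
  by apply: ge_sup => [|_ [y _ <-]//]; exists `|f x|, x.
by rewrite /sup_norm sup_out// => -[[_ [x _ _]] _]; apply: T0; exists x.
Qed.

Lemma sup_normD f g : has_ubound (range (fun x => `|f x|)) ->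
  has_ubound (range (fun x => `|g x|)) ->
  sup_norm (f + g) <= sup_norm f + sup_norm g.
Proof.
move=> fb gb; apply: sup_norm_le => [|x]; first by rewrite addr_ge0 ?sup_norm_ge0.
by rewrite (le_trans (ler_normD _ _))// lerD// sup_norm_ub.
Qed.

Lemma sup_normZ (l : R) f : has_ubound (range (fun x => `|f x|)) ->
  sup_norm (l *: f) = `|l| * sup_norm f.
Proof.
move=> fb; have lf x : `|(l *: f) x| = `|l| * `|f x| by rewrite -normrM.
have le : sup_norm (l *: f) <= `|l| * sup_norm f.
  apply: sup_norm_le => [|x]; first by rewrite mulr_ge0 ?sup_norm_ge0.
  by rewrite lf ler_wpM2l ?sup_norm_ub.
have [->|l0] := eqVneq l 0.
  apply/eqP; rewrite normr0 mul0r eq_le sup_norm_ge0 andbT.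
  by apply: sup_norm_le => // x; rewrite scale0r normr0.
apply/eqP; rewrite eq_le le/= mulrC -ler_pdivlMr ?normr_gt0//.
apply: sup_norm_le => [|x]; first by rewrite divr_ge0 ?sup_norm_ge0.
rewrite ler_pdivlMr ?normr_gt0// mulrC -lf sup_norm_ub//.
exists (`|l| * sup_norm f) => _ [y _ <-].
by rewrite lf ler_wpM2l ?sup_norm_ub.
Qed.

Lemma sup_norm0_eq0 f : has_ubound (range (fun x => `|f x|)) ->
  sup_norm f = 0 -> f = 0.
Proof.
move=> fb f0; apply/funext => x; apply/eqP.
by rewrite -normr_le0 -f0 sup_norm_ub.
Qed.

Lemma sup_norm_complete (V : normedModType R) (v : V -> T -> R) :
  (forall f g : V, v (f - g) = v f - v g) ->
  (forall (f : V) x, `|v f x| <= `|f|) ->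
  (forall (f : V) (M : R), 0 <= M -> (forall x, `|v f x| <= M) -> `|f| <= M) ->
  (forall h, (forall e : R, 0 < e -> exists f : V, forall x, `|h x - v f x| <= e) ->
    exists f : V, v f = h) ->
  forall F : set_system V, ProperFilter F -> cauchy F -> cvg F.
Proof.
move=> vB vle leV vcl F FF /cauchyP Fc.
have ptcvg x : cvg ((v ^~ x) @ F).
  apply: cauchy_cvg; apply/cauchyP => e e0.
  have [f Ff] := Fc _ e0; exists (v f x); rewrite nbhs_simpl/=.
  apply: filterS Ff => g; rewrite -!ball_normE/= => /le_lt_trans; apply.
  by rewrite (le_trans _ (vle _ x))// vB.
pose h x : R := lim ((v ^~ x) @ F).
have near_h (f : V) (e : R) : F (ball f e) -> forall x, `|h x - v f x| <= e.
  move=> Ff x; have hx : (fun g : V => `|v g x - v f x|) @ F --> `|h x - v f x|.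
    by apply: cvg_norm; apply: cvgB; [exact: ptcvg|exact: cvg_cst].
  apply: (@closed_cvg _ _ F FF _ [set y | y <= e] (@closed_le R e) _ _ hx).
  apply: filterS Ff => g; rewrite -ball_normE/= => /ltW; apply: le_trans.
  by rewrite distrC (le_trans _ (vle _ x))// vB.
have [f fh] : exists f : V, v f = h.
  by apply: vcl => e /Fc[f Ff]; exists f; exact: near_h.
apply/cvg_ex; exists f; apply/cvgrPdist_le => e e0.
have [g Fg] := Fc _ (divr_gt0 e0 (ltr0n R 2)).
apply: filterS (Fg) => k gk; rewrite (splitr e).
apply: leV => [|x]; first by rewrite addr_ge0 ?divr_ge0 ?ltW.
have -> : v (f - k) x = (h x - v g x) + v (g - k) x.
  by rewrite !vB fh; rewrite /= addrA subrK.
rewrite (le_trans (ler_normD _ _))// lerD//; first exact: near_h.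
by rewrite (le_trans (vle _ x))//; move: gk; rewrite -ball_normE => /ltW.
Qed.

End sup_norm.

Section continuous_functions.
Context {R : realType} {K : topologicalType}.

Definition cont_fun : {pred (K -> R)} :=
  mem [set f : K -> R | continuous f].

Lemma cont_fun_submod_closed : submod_closed cont_fun.
Proof.
split=> [|a f g]; rewrite !inE /=; first by move=> x; exact: cvg_cst.
by move=> cf cg x; apply: cvgD (cg x); apply: cvgZr; exact: cf.
Qed.

HB.instance Definition _ :=
  GRing.isSubmodClosed.Build R (K -> R) cont_fun cont_fun_submod_closed.

(** The compactness proof [cK] only serves to make the supremum norm finite. *)
Record C_space (cK : compact [set: K]) := CSpace {
  C_val :> K -> R ;
  C_valP : C_val \in cont_fun }.

Context (cK : compact [set: K]).

HB.instance Definition _ := [isSub of C_space cK for @C_val cK].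
HB.instance Definition _ := [Choice of C_space cK by <:].
HB.instance Definition _ := [SubChoice_isSubLmodule of C_space cK by <:].

Implicit Types f g : C_space cK.

Lemma C_continuous f : continuous f.
Proof. by have := C_valP f; rewrite inE. Qed.

Lemma C_bounded f : has_ubound (range (fun x => `|f x|)).
Proof.
have fK : compact (f @` [set: K]).
  by apply: continuous_compact cK; apply: continuous_subspaceT;
    exact: C_continuous.
have [M [_ fM]] := compact_bounded fK.
by exists (M + 1) => _ [x _ <-]; apply: (fM (M + 1)); rewrite ?ltrDl//; exists x.
Qed.

Definition C_norm f : R := sup_norm f.

Lemma C_normD f g : C_norm (f + g) <= C_norm f + C_norm g.
Proof. exact: sup_normD (C_bounded f) (C_bounded g). Qed.

Lemma C_normZ (l : R) f : C_norm (l *: f) = `|l| * C_norm f.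
Proof. exact: sup_normZ (C_bounded f). Qed.

Lemma C_norm0_eq0 f : C_norm f = 0 -> f = 0.
Proof. by move=> /(sup_norm0_eq0 (C_bounded f)) f0; exact: val_inj. Qed.

HB.instance Definition _ :=
  Lmodule_isNormed.Build R (C_space cK) C_normD C_normZ C_norm0_eq0.

Lemma C_complete (F : set_system (C_space cK)) :
  ProperFilter F -> cauchy F -> cvg F.
Proof.
move: F; apply: (@sup_norm_complete _ _ (C_space cK) (@C_val cK)).
- by [].
- by move=> f x; exact: sup_norm_ub (C_bounded f).
- by move=> f M; exact: sup_norm_le.
move=> h hlim; have ch : h \in cont_fun; last by exists (CSpace cK ch).
rewrite inE => x; apply/cvgrPdist_le => e e0.
have e30 : 0 < e / 3 by rewrite divr_gt0.
have [f hf] := hlim _ e30.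
have /cvgrPdist_le /(_ _ e30) := @C_continuous f x.
apply: filterS => y fxy.
have -> : h x - h y = (h x - f x) + ((f x - f y) + (f y - h y)).
  by ring.
have -> : e = e / 3 + (e / 3 + e / 3) by field.
rewrite (le_trans (ler_normD _ _))// lerD//.
by rewrite (le_trans (ler_normD _ _))// lerD// distrC.
Qed.

HB.instance Definition _ := Uniform_isComplete.Build (C_space cK) C_complete.

End continuous_functions.

Arguments C_space R {K} cK.

Section null_sequences.
Context {R : realType}.

Definition null_seq : {pred (nat -> R)} :=
  mem [set u : nat -> R | u @ \oo --> 0].

Lemma null_seq_submod_closed : submod_closed null_seq.
Proof.
split=> [|a f g]; rewrite !inE /=; first exact: cvg_cst.
move=> cf cg; have -> : (0 : R) = a *: (0 : R^o) + 0 by rewrite scaler0 addr0.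
by apply: cvgD cg; apply: cvgZr.
Qed.

HB.instance Definition _ :=
  GRing.isSubmodClosed.Build R (nat -> R) null_seq null_seq_submod_closed.

Record c0_space := C0Space {
  c0_val :> nat -> R ;
  c0_valP : c0_val \in null_seq }.

HB.instance Definition _ := [isSub of c0_space for c0_val].
HB.instance Definition _ := [Choice of c0_space by <:].
HB.instance Definition _ := [SubChoice_isSubLmodule of c0_space by <:].

Implicit Types u v : c0_space.

Lemma c0_cvg u : c0_val u @ \oo --> (0 : R).
Proof. by have := c0_valP u; rewrite inE. Qed.

Lemma c0_bounded u : has_ubound (range (fun n => `|u n|)).
Proof.
have /cvg_seq_bounded[M [_ uM]] : cvgn (c0_val u).
  by apply/cvg_ex; exists 0; exact: c0_cvg.
by exists (M + 1) => _ [n _ <-]; apply: (uM (M + 1)); rewrite ?ltrDl.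
Qed.

Definition c0_norm u : R := sup_norm u.

Lemma c0_normD u v : c0_norm (u + v) <= c0_norm u + c0_norm v.
Proof. exact: sup_normD (c0_bounded u) (c0_bounded v). Qed.

Lemma c0_normZ (l : R) u : c0_norm (l *: u) = `|l| * c0_norm u.
Proof. exact: sup_normZ (c0_bounded u). Qed.

Lemma c0_norm0_eq0 u : c0_norm u = 0 -> u = 0.
Proof. by move=> /(sup_norm0_eq0 (c0_bounded u)) u0; exact: val_inj. Qed.

HB.instance Definition _ :=
  Lmodule_isNormed.Build R c0_space c0_normD c0_normZ c0_norm0_eq0.

Lemma c0_complete (F : set_system c0_space) :
  ProperFilter F -> cauchy F -> cvg F.
Proof.
move: F; apply: (@sup_norm_complete _ _ c0_space c0_val).
- by [].
- by move=> u n; exact: sup_norm_ub (c0_bounded u).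
- by move=> u M; exact: sup_norm_le.
move=> h hlim; have ch : h \in null_seq; last by exists (C0Space ch).
rewrite inE; apply/cvgrPdist_le => e e0.
have e20 : 0 < e / 2 by rewrite divr_gt0.
have [u hu] := hlim _ e20.
have /cvgrPdist_le /(_ _ e20) := @c0_cvg u.
apply: filterS => n; rewrite !sub0r !normrN => un.
rewrite -(subrK (u n) (h n)) (splitr e).
by rewrite (le_trans (ler_normD _ _))// lerD.
Qed.

HB.instance Definition _ := Uniform_isComplete.Build c0_space c0_complete.

End null_sequences.

Arguments c0_space R : clear implicits.

(** For a linear map [f], [bounded_near f (nbhs 0)] is the library's notion of
    bounded operator (see [linear_boundedP], [linear_bounded_continuous]).
    [twisted_sum Y X] is the type of exact sequences 0 -> Y -> Z -> X -> 0. *)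
Record twisted_sum (R : realType) (Y X : completeNormedModType R) :=
  TwistedSum {
    ts_space : completeNormedModType R ;
    ts_inj : {linear Y -> ts_space} ;
    ts_proj : {linear ts_space -> X} ;
    ts_inj_bounded : bounded_near ts_inj (nbhs 0) ;
    ts_proj_bounded : bounded_near ts_proj (nbhs 0) ;
    ts_exactl : injective ts_inj ;
    ts_exactm : range ts_inj = ts_proj @^-1` [set 0] ;
    ts_exactr : range ts_proj = setT }.

Definition trivial_twisted_sum (R : realType) (Y X : completeNormedModType R)
    (s : twisted_sum Y X) : Prop :=
  exists r : {linear ts_space s -> Y},
    bounded_near r (nbhs 0) /\ cancel (ts_inj s) r.

Definition Ext_neq0 (R : realType) (X Y : completeNormedModType R) : Prop :=
  exists s : twisted_sum Y X, ~ trivial_twisted_sum s.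

(* Main.v *)
(** Given an almost disjoint family (A_l) of subsets of nat and differences
    g_l = c_l (delta_(x_l) - delta_(y_l)) of point masses on K such that, for
    every f in C(K), all but finitely many g_l(f) are small, the map
    f |-> sum_l g_l(f) 1_(A_l) from C(K) to l^oo / c0 pulls
    0 -> c0 -> l^oo -> l^oo / c0 -> 0 back to a twisted sum of c0 and C(K).
    If it is trivial, there is a bounded sequence (nu_s) of functionals on C(K)
    with nu_s(f) -> g_l(f) as s tends to infinity along A_l, for all l.

    For K included in a Sigma-product, pairs (x_l, y_l) that differ on pairwise
    disjoint sets of coordinates satisfy the smallness condition.  Two
    configurations contradict the existence of (nu_s): uncountably many such
    pairs, with the x_l in pairwise disjoint open sets, as each nu_s is away
    from 0 on finitely many functions with disjoint supports only; or continuum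
    many such pairs with x_l in U_n, for each term of a sequence (U_n) of
    disjoint open sets, by diagonalization over the possible sets
    M_n = {s | nu_s is not small on U_n}.

    If neither occurs, call an open set heavy if it contains continuum many x_l
    as above.  The points all of whose neighbourhoods are heavy form a finite
    set, a maximal family of pairs in disjoint non-heavy open sets is countable,
    and a non-heavy set is separated by less than continuum many coordinates.
    Hence less than continuum many coordinates are nonzero somewhere on K, so
    that the weight of K is less than the continuum. *)

Require Import Defs.
From HB Require Import structures.
From mathcomp Require Import all_boot all_order all_algebra.
From mathcomp Require Import all_classical all_reals all_analysis.
From mathcomp Require Import ring lra.

Import Order.TTheory GRing.Theory Num.Theory.
Import numFieldNormedType.Exports.

Local Open Scope classical_set_scope.
Local Open Scope ring_scope.
Local Open Scope card_scope.

(** * Sets of cardinality less than the continuum *)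

(** By comparability of cardinals this says that [A] has fewer than continuum many elements. With
    [nat -> bool] in place of the reals, one and the same index names a branch of the binary tree
    and, through [slice], a sequence of sets of integers. *)
Definition small {T : Type} (A : set T) : Prop :=
  ~ exists f : (nat -> bool) -> T, (forall l, A (f l)) /\ injective f.

Lemma small_inj {T U : Type} (f : T -> U) (A : set T) (B : set U) :
  (forall x, A x -> B (f x)) ->
  (forall x y, A x -> A y -> f x = f y -> x = y) -> small B -> small A.
Proof.
move=> fAB finj sB [g [gA ginj]]; apply: sB; exists (f \o g); split=> [l|l m /=].
  exact: fAB.
by move/finj => /(_ (gA _) (gA _))/ginj.
Qed.

Lemma small_sub {T : Type} (A B : set T) : A `<=` B -> small B -> small A.
Proof. by move=> AB; apply: (@small_inj _ _ id) => // x /AB. Qed.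

Lemma small_image {T U : Type} (f : T -> U) (A : set T) :
  small A -> small (f @` A).
Proof.
move=> sA [g [gA ginj]]; apply: sA.
have /choice[h hP] : forall l, exists x, A x /\ f x = g l.
  by move=> l; have [x Ax fx] := gA l; exists x.
exists h; split=> [l|l m hlm]; first by have [] := hP l.
by apply: ginj; have [_ <-] := hP l; have [_ <-] := hP m; rewrite hlm.
Qed.

Definition slice (l : nat -> bool) (n m : nat) : bool := l (pickle (n, m)).

Lemma exists_slice (a : nat -> nat -> bool) : exists l, slice l = a.
Proof.
exists (fun k => if unpickle k is Some (n, m) then a n m else false).
by apply/funext => n; apply/funext => m; rewrite /slice pickleK.
Qed.

(* Koenig: some [a n] is not a slice of any [l] with [f l] in [F n], and one [l]
   has all the [a n] as its slices. *)
Lemma small_bigcup {T : Type} (F : nat -> set T) :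
  (forall n, small (F n)) -> small (\bigcup_n F n).
Proof.
move=> sF [f [fF finj]].
have /choice[a aP] : forall n, exists a : nat -> bool,
    forall l, F n (f l) -> slice l n <> a.
  move=> n; apply: contrapT => /forallNP na; apply: (sF n).
  have /choice[h hP] : forall a, exists l, F n (f l) /\ slice l n = a.
    move=> a; apply: contrapT => /forallNP nl; apply: (na a) => l Fl la.
    by apply: (nl l).
  exists (f \o h); split=> [a|a b /= /finj hab]; first by have [] := hP a.
  by have [_ <-] := hP a; have [_ <-] := hP b; rewrite hab.
have [l la] := exists_slice a; have [n _ Fn] := fF l.
by apply: (aP n l Fn); rewrite la.
Qed.

(** A countable set is the union of the fibres of an injection into [nat], each of at most one
    point. *)
Lemma small_countable {T : Type} (A : set T) : countable A -> small A.
Proof.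
move=> /countable_injP[e einj].
apply: (@small_sub _ _ (\bigcup_n [set x | A x /\ e x = n])).
  by move=> x Ax; exists (e x).
apply: small_bigcup => n [f [fA finj]].
have : f (fun=> true) = f (fun=> false).
  have [A1 e1] := fA (fun=> true); have [A2 e2] := fA (fun=> false).
  by apply: einj; rewrite ?inE// e1 e2.
by move=> /finj/(congr1 (@^~ 0%N)).
Qed.

Lemma smallU {T : Type} (A B : set T) : small A -> small B -> small (A `|` B).
Proof.
move=> sA sB; apply: (@small_sub _ _ (\bigcup_n (if n is 0%N then A else B))).
  by move=> x [Ax|Bx]; [exists 0%N|exists 1%N].
by apply: small_bigcup => -[|n].
Qed.

(** Once every [F x] is enumerated by a sequence, the [n]-th terms form an image of [D], and these
    countably many images cover the union. *)
Lemma small_bigcup_countable {T U : Type} (D : set T) (F : T -> set U) :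
  small D -> (forall x, D x -> countable (F x)) -> small (\bigcup_(x in D) F x).
Proof.
move=> sD cF; have [[u0 _]|U0] := pselect ([set: U] !=set0); last first.
  by move=> [f _]; apply: U0; exists (f xpredT).
have /choice[e eP] : forall x, exists e : nat -> U, D x -> F x `<=` range e.
  move=> x; have [Dx|nDx] := pselect (D x); last by exists (fun=> u0).
  have /countable_injP[g ginj] := cF _ Dx.
  have /choice[e eP] : forall n, exists u, forall v, F x v -> g v = n -> u = v.
    move=> n; have [[v [Fv gv]]|nv] := pselect (exists v, F x v /\ g v = n).
      by exists v => w Fw gw; apply: ginj; rewrite ?inE// gv gw.
    by exists u0 => v Fv gv; exfalso; apply: nv; exists v.
  by exists e => _ v Fv; exists (g v) => //; exact: eP.
apply: (@small_sub _ _ (\bigcup_n (fun x => e x n) @` D)).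
  by move=> u [x Dx /(eP _ Dx)[n _ <-]]; exists n => //; exists x.
by apply: small_bigcup => n; exact: small_image.
Qed.

(** * Comparability of cardinals and pairings on infinite sets *)

Lemma card_le_injfun {T U : Type} (u0 : U) (A : set T) (B : set U) : A #<= B ->
  exists f : T -> U, (forall x, A x -> B (f x)) /\
    (forall x y, A x -> A y -> f x = f y -> x = y).
Proof.
move=> /card_leP[f].
pose g (x : T) : U := 
  if pselect (A x) is left Ax then \val (f (exist _ x (mem_set Ax))) else u0.
exists g; split=> [x Ax|x y Ax Ay]; rewrite /g; case: pselect => // Ax'.
  exact: set_valP.
case: pselect => // Ay' /val_inj fxy.
have : exist _ x (mem_set Ax') = exist _ y (mem_set Ay') :> A.
  by apply: (@inj _ _ _ f) fxy; rewrite inE.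
by case.
Qed.

(** Copied into the disjoint sum, the two sets become members of one family, and a member of least
    cardinality embeds into the other. *)
Lemma card_le_total {T U : Type} (A : set T) (B : set U) : A #<= B \/ B #<= A.
Proof.
pose P : set (set (T + U)) := [set inl @` A; inr @` B].
have [C PC Cmin] : exists2 C, P C & forall C', P C' -> C #<= C'.
  by apply: exists_card_min; exists (inl @` A); left.
have eA : (inl @` A : set (T + U)) #= A by apply: inj_card_eq => x y _ _ [].
have eB : (inr @` B : set (T + U)) #= B by apply: inj_card_eq => x y _ _ [].
case: PC => CE; [left|right].
  have := Cmin (inr @` B) (or_intror erefl).
  by rewrite CE (card_le_eql eA) (card_le_eqr eB).
have := Cmin (inl @` A) (or_introl erefl).
by rewrite CE (card_le_eql eB) (card_le_eqr eA).
Qed.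

Definition pairing_on {T : Type} (A : set T) (f : T -> T -> T) : Prop :=
  (forall x y, A x -> A y -> A (f x y)) /\
  (forall x y x' y', A x -> A y -> A x' -> A y' ->
    f x y = f x' y' -> x = x' /\ y = y').

Lemma pairing_on_card {T U : Type} (i : T -> U) (j : U -> T) (B : set T)
    (A : set U) (f : T -> T -> T) :
  (forall x, B x -> A (i x)) ->
  (forall x y, B x -> B y -> i x = i y -> x = y) ->
  (forall x, A x -> B (j x)) ->
  (forall x y, A x -> A y -> j x = j y -> x = y) ->
  pairing_on B f -> pairing_on A (fun x y => i (f (j x) (j y))).
Proof.
move=> iBA iinj jAB jinj [fB finj]; split=> [x y Ax Ay|x y x' y' Ax Ay Ax' Ay'].
  by apply/iBA/fB; exact: jAB.
move=> /iinj -/(_ (fB _ _ (jAB _ Ax) (jAB _ Ay)) (fB _ _ (jAB _ Ax') (jAB _ Ay'))).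
move=> /finj -/(_ (jAB _ Ax) (jAB _ Ay) (jAB _ Ax') (jAB _ Ay')).
by case=> /jinj -> // /jinj ->.
Qed.

Section infinite_pairing.
Context {T : Type} (A : set T).
Implicit Types G : set (T * T * T).

(** A partial pairing is represented by its graph, so that Zorn's lemma applies to unions of chains;
    its domain is read off the diagonal. A good graph may give several values to a pair, and
    [good_pairing] selects one. *)
Let dom G : set T := [set x | exists z, G (x, x, z)].

Let good G := [/\ forall x y z, G (x, y, z) -> [/\ dom G x, dom G y & dom G z],
  dom G `<=` A, forall x y, dom G x -> dom G y -> exists z, G (x, y, z) &
  forall x y z x' y', G (x, y, z) -> G (x', y', z) -> x = x' /\ y = y'].

Let good_pairing G : good G -> exists f, pairing_on (dom G) f.
Proof.
move=> [Gd _ Gt Gi].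
have /choice[f fP] : forall p : T * T, exists z,
    dom G p.1 -> dom G p.2 -> G (p.1, p.2, z).
  move=> [x y]; have [[dx dy]|nd] := pselect (dom G x /\ dom G y).
    by have [z Gz] := Gt _ _ dx dy; exists z.
  by exists x => dx dy; exfalso; apply: nd.
exists (fun x y => f (x, y)); split=> [x y dx dy|x y x' y' dx dy dx' dy' fxy].
  by have [] := Gd _ _ _ (fP (x, y) dx dy).
have G1 := fP (x, y) dx dy; have G2 := fP (x', y') dx' dy'.
by apply: (Gi _ _ (f (x, y))) => //; rewrite fxy.
Qed.

Let good_bigcup (F : set (set (T * T * T))) :
  (forall G, F G -> good G) -> total_on F subset -> good (\bigcup_(G in F) G).
Proof.
move=> Fg Ft.
have sub G : F G -> G `<=` \bigcup_(G in F) G by move=> FG x Gx; exists G.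
have dsub G : F G -> dom G `<=` dom (\bigcup_(G in F) G).
  by move=> FG x [z Gz]; exists z; exact: (sub G).
have two G G' : F G -> F G' -> exists H, [/\ F H, G `<=` H & G' `<=` H].
  by move=> FG FG'; have [GG'|G'G] := Ft _ _ FG FG';
    [exists G'|exists G]; split.
split.
- move=> x y z [G FG Gz]; have [gd _ _ _] := Fg _ FG.
  by have [dx dy dz] := gd _ _ _ Gz; split; exact: (dsub G).
- by move=> x [z [G FG Gz]]; have [_ GA _ _] := Fg _ FG; apply: GA; exists z.
- move=> x y [z [G FG Gz]] [z' [G' FG' Gz']].
  have [H [FH GH G'H]] := two _ _ FG FG'; have [_ _ gt _] := Fg _ FH.
  have [w Hw] : exists w, H (x, y, w).
    by apply: gt; [exists z; exact: GH|exists z'; exact: G'H].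
  by exists w; exact: (sub H).
move=> x y z x' y' [G FG Gz] [G' FG' Gz'].
have [H [FH GH G'H]] := two _ _ FG FG'; have [_ _ _ gi] := Fg _ FH.
by apply: (gi _ _ z); [exact: GH|exact: G'H].
Qed.

(* The three new blocks of [(B `|` C) * (B `|` C)], where [B] is the domain of [G]
   and [C] is its image under [g], are sent into [C]; the tags [b 0], [b 1] and
   [b 2] make their images disjoint. *)
Let good_extend G (g : T -> T) (b : nat -> T) : good G ->
  (forall n, dom G (b n)) -> injective b ->
  (forall x, dom G x -> A (g x) /\ ~ dom G (g x)) ->
  (forall x y, dom G x -> dom G y -> g x = g y -> x = y) ->
  exists2 G', good G' & G `<` G'.
Proof.
move=> gG db binj gA ginj; have [f [fd finj]] := good_pairing _ gG.
have [Gd GA Gt Gi] := gG.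
pose C := g @` dom G.
have CA x : C x -> A x by move=> [y /gA[? _] <-].
have Cd x : C x -> ~ dom G x by move=> [y /gA[_ ?] <-].
(* [r] folds the union of [B] and [C] onto [B]: it is the identity on [B] and inverts [g] on [C]. *)
have /choice[r rP] : forall x, exists y, dom G x \/ C x ->
    dom G y /\ ((dom G x /\ y = x) \/ (C x /\ x = g y)).
  move=> x; have [dx|ndx] := pselect (dom G x).
    by exists x => _; split => //; left.
  have [Cx|nCx] := pselect (C x); last by exists x => -[].
  by have [y dy yx] := Cx; exists y => _; split => //; right; split.
pose tag x y : nat := if pselect (dom G x) then 0%N else 
   if pselect (dom G y) then 1%N else 2%N.
pose F x y := g (f (b (tag x y)) (f (r x) (r y))).
pose N : set (T * T * T) := [set p | [/\ dom G p.1.1 \/ C p.1.1,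
  dom G p.1.2 \/ C p.1.2, ~ (dom G p.1.1 /\ dom G p.1.2) & p.2 = F p.1.1 p.1.2]].
have dN x : dom (G `|` N) x <-> dom G x \/ C x.
  split=> [[z [Gz|[]//]]|[[z Gz]|Cx]]; first by left; exists z.
    by exists z; left.
  by exists (F x x); right; split; [right|right|move=> [/(Cd _ Cx)]|].
have frP x y : dom G x \/ C x -> dom G y \/ C y -> dom G (f (r x) (r y)).
  by move=> /rP[drx _] /rP[dry _]; exact: fd.
have FC x y : dom G x \/ C x -> dom G y \/ C y -> C (F x y).
  move=> hx hy; exists (f (b (tag x y)) (f (r x) (r y))) => //.
  by apply: fd (db _) _; exact: frP.
exists (G `|` N); last first.
  split; first exact: subsetUl.
  have Cg : C (g (b 0%N)) by exists (b 0%N).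
  move=> NG; have [|/(Cd _ Cg)//] := Gd (g (b 0%N)) (g (b 0%N))
    (F (g (b 0%N)) (g (b 0%N))).
  by apply: NG; right; split; [right|right|move=> [/(Cd _ Cg)]|].
split.
- move=> x y z [/Gd[dx dy dz]|[/= hx hy _ ->]].
    by split; apply/dN; left.
  by split; apply/dN => //; right; exact: FC.
- by move=> x /dN[/GA|/CA].
- move=> x y /dN hx /dN hy.
  have [[dx dy]|nxy] := pselect (dom G x /\ dom G y).
    by have [z Gz] := Gt _ _ dx dy; exists z; left.
  by exists (F x y); right.
move=> x y z x' y' [Gz|[/= hx hy nxy zE]] [Gz'|[/= hx' hy' nxy' zE']].
- exact: Gi Gz Gz'.
- by have [_ _ dz] := Gd _ _ _ Gz; case: (Cd z) => //; rewrite zE'; exact: FC.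
- by have [_ _ dz] := Gd _ _ _ Gz'; case: (Cd z) => //; rewrite zE; exact: FC.
move: zE'; rewrite zE => /ginj -/(_ (fd _ _ (db _) (frP _ _ hx hy))).
move=> /(_ (fd _ _ (db _) (frP _ _ hx' hy'))) /finj.
move=> /(_ (db _) (frP _ _ hx hy) (db _) (frP _ _ hx' hy'))[/binj tE].
have [dx rx] := rP _ hx; have [dy ry] := rP _ hy.
have [dx' rx'] := rP _ hx'; have [dy' ry'] := rP _ hy'.
move=> /finj -/(_ dx dy dx' dy')[rxE ryE].
(* A point is recovered from its image under [r] and from whether it lies in [B]; the tag tells the
   latter for both coordinates of a new pair. *)
have key u u' : ((dom G u /\ r u = u) \/ (C u /\ u = g (r u))) ->
    ((dom G u' /\ r u' = u') \/ (C u' /\ u' = g (r u'))) ->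
    (dom G u <-> dom G u') -> r u = r u' -> u = u'.
  move=> [[du ru]|[Cu ru]] [[du' ru']|[Cu' ru']] uu' rE.
  - by rewrite -ru rE.
  - by case: (Cd _ Cu'); apply/uu'.
  - by case: (Cd _ Cu); apply/uu'.
  - by rewrite ru rE.
have tag0 u v : dom G u -> tag u v = 0%N by rewrite /tag; case: pselect.
have tag1 u v : ~ dom G u -> dom G v -> tag u v = 1%N.
  by rewrite /tag; case: pselect => //; case: pselect.
have tag2 u v : ~ dom G u -> ~ dom G v -> tag u v = 2%N.
  by rewrite /tag; case: pselect => //; case: pselect.
have [dGx|dGx] := pselect (dom G x); have [dGx'|dGx'] := pselect (dom G x');
  have [dGy|dGy] := pselect (dom G y); have [dGy'|dGy'] := pselect (dom G y');
  try (by case: nxy); try (by case: nxy');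
  move: tE; rewrite ?(tag0 _ _ dGx) ?(tag0 _ _ dGx') ?(tag1 _ _ dGx dGy)
    ?(tag1 _ _ dGx' dGy') ?(tag2 _ _ dGx dGy) ?(tag2 _ _ dGx' dGy') // => _;
  by split; apply: key => //; split.
Qed.

(* Hessenberg: a maximal injection [B * B -> B] with [B] included in [A] is such
   that [A `\` B] embeds into [B], otherwise it could be extended. *)
Lemma infinite_pairing : infinite_set A -> exists f, pairing_on A f.
Proof.
move=> /infiniteP Ainf.
have [x0 _] : A !=set0.
  by apply/infinite_setN0/infiniteP.
have [i [iA iinj]] := card_le_injfun x0 _ _ Ainf.
have {}iA n : A (i n) by exact: iA.
have {}iinj : injective i by move=> m n; exact: iinj.
pose G0 : set (T * T * T) :=
  [set p | exists m n, p = (i m, i n, i (pickle (m, n)))].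
have dG0 x : dom G0 x <-> exists n, x = i n.
  split=> [[z [m [n [-> _ _]]]]|[n ->]]; first by exists m.
  by exists (i (pickle (n, n))), n, n.
have gG0 : good G0.
  split=> [x y z [m [n [-> -> ->]]]|x /dG0[n ->]//|x y /dG0[m ->] /dG0[n ->]|].
  - by split; apply/dG0; [exists m|exists n|exists (pickle (m, n))].
  - by exists (i (pickle (m, n))), m, n.
  move=> x y z x' y' [m [n [-> -> ->]]] [m' [n' [-> ->]]] /iinj.
  by move=> /(pcan_inj pickleK)[-> ->].
(* The alternative [G = set0] accounts for the empty chain in Zorn's lemma. *)
pose P G := good G /\ (G = set0 \/ G0 `<=` G).
have [G [[gG G0G] Gmax]] : exists G, P G /\ forall G', G `<` G' -> ~ P G'.
  apply: (@Zorn_bigcup _ P) => F FP Ft; split.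
    by apply: good_bigcup => // G /FP[].
  have [[G [FG G0G]]|nG] := pselect (exists G, F G /\ G0 `<=` G).
    by right; apply: (subset_trans G0G) => x Gx; exists G.
  left; apply/seteqP; split=> // x [G FG].
  have [_ [->//|G0G]] := FP _ FG.
  by exfalso; apply: nG; exists G.
have {}G0G : G0 `<=` G.
  case: G0G => // G00; exfalso; apply: (Gmax G0); last by split=> //; right.
  rewrite G00; split=> // /(_ (i 0%N, i 0%N, i (pickle (0%N, 0%N)))).
  by apply; exists 0%N, 0%N.
have di n : dom G (i n).
  by exists (i (pickle (n, n))); apply: G0G; exists n, n.
have [f fpair] := good_pairing _ gG; have [fd finj] := fpair.
have [_ GA _ _] := gG.
have [AB|BA] := card_le_total (A `\` dom G) (dom G); last first.
  have [g [gA ginj]] := card_le_injfun x0 _ _ BA.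
  have [|G' gG' GG'] := good_extend _ g i gG di iinj _ ginj.
    by move=> x /gA[].
  exfalso; apply: (Gmax _ GG'); split=> //; right.
  by apply: (subset_trans G0G); exact: properW.
have [g [gA ginj]] := card_le_injfun x0 _ _ AB.
(* [j] injects all of [A] into [B]; the tags [i 0] and [i 1] keep the images of [B] and of its
   complement apart. *)
pose j x := if pselect (dom G x) then f (i 0%N) x else f (i 1%N) (g x).
have jd x : A x -> dom G (j x).
  move=> Ax; rewrite /j; case: pselect => dx; first exact: fd.
  by apply: fd => //; exact: gA.
have jinj x y : A x -> A y -> j x = j y -> x = y.
  move=> Ax Ay; rewrite /j; case: pselect => dx; case: pselect => dy.
  - by move=> /finj[].
  - by move=> /finj -[]// ; [exact: gA|move=> /iinj].
  - by move=> /finj -[]// ; [exact: gA|move=> /iinj].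
  - by move=> /finj -[]// ; [exact: gA|exact: gA|move=> _ /ginj; exact].
exists (fun x y => f (j x) (j y)).
by apply: (pairing_on_card id j (dom G) A f).
Qed.

End infinite_pairing.

(** By symmetry [A] embeds into [B]. If [B] is uncountable, the product then embeds into the square
    of [B], which a pairing sends back into [B]. *)
Lemma small_setX {T U : Type} (A : set T) (B : set U) :
  small A -> small B -> small (A `*` B).
Proof.
wlog : T U A B / A #<= B => [hwlog|AB].
  have [AB|BA] := card_le_total A B; first exact: hwlog.
  move=> sA sB; apply: (@small_inj _ _ (fun p => (p.2, p.1)) _ (B `*` A)).
  - by move=> [x y] [].
  - by move=> [x y] [x' y'] _ _ [-> ->].
  - exact: hwlog.
move=> sA sB; have [cB|ncB] := pselect (countable B).
  by apply/small_countable/countableX => //; exact: sub_countable AB cB.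
have infB : infinite_set B by move=> /finite_set_countable.
have [u0 _] := infinite_setN0 infB.
have [g [gB ginj]] := card_le_injfun u0 _ _ AB.
have [f [fB finj]] := infinite_pairing _ infB.
apply: (@small_inj _ _ (fun p => f (g p.1) p.2) _ B) => //.
  by move=> [x y] [/= Ax By]; apply: fB => //; exact: gB.
move=> [x y] [x' y'] [/= Ax By] [/= Ax' By'] /finj[]//; [exact: gB|exact: gB|].
by move=> /ginj -> // ->.
Qed.

Lemma small_lists {T : Type} (A : set T) : small A ->
  small [set s : seq T | forall x, List.In x s -> A x].
Proof.
move=> sA.
pose L n := [set s : seq T | size s = n /\ forall x, List.In x s -> A x].
apply: (@small_sub _ _ (\bigcup_n L n)) => [s sP|]; first by exists (size s).
apply: small_bigcup; elim=> [|n IH].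
  apply: (@small_sub _ _ [set [::]]) => [s [/size0nil -> //]|].
  exact/small_countable/countable1.
apply: (@small_sub _ _ ((fun p => p.1 :: p.2) @` (A `*` L n))); last first.
  by apply: small_image; exact: small_setX.
move=> [|x s] [//= [sn] xsA]; exists (x, s) => //; split=> /=.
  by apply: xsA; left.
by split=> // y ys; apply: xsA; right.
Qed.

(** * Twisted sums defined by differences of point masses *)

(** The coefficients [tw_c] make room for the second criterion, where pairs taken from the [n]-th
    open set are damped by [1/(n+1)]. *)
Record twist_data (R : realType) (K : topologicalType) := TwistData {
  tw_index : Type ;
  tw_A : tw_index -> set nat ;
  tw_x : tw_index -> K ;
  tw_y : tw_index -> K ;
  tw_c : tw_index -> R ;
  tw_c1 : forall l, `|tw_c l| <= 1 }.

Arguments tw_index {R K} d : rename.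
Arguments tw_A {R K} d l : rename.
Arguments tw_x {R K} d l : rename.
Arguments tw_y {R K} d l : rename.
Arguments tw_c {R K} d l : rename.
Arguments tw_c1 {R K} d l : rename.

(** The tolerance [e / (2 * (1 + a))] absorbs a factor [a] and stays meaningful for [a = 0]. *)
Lemma mul_half_le {R : realType} (a e : R) : 0 <= a -> 0 <= e ->
  a * (e / (2 * (1 + a))) <= e / 2.
Proof.
move=> a0 e0; rewrite mulrA ler_pdivrMr ?mulr_gt0 ?ltr_pwDl//.
have -> : e / 2 * (2 * (1 + a)) = e + a * e by field.
by rewrite lerDr.
Qed.

Section twist_space.
Context {R : realType} {K : topologicalType} (d : twist_data R K).

Definition tw_gamma (f : K -> R) (l : tw_index d) : R :=
  tw_c d l * (f (tw_x d l) - f (tw_y d l)).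

Lemma tw_gammaD f g l : tw_gamma (f + g) l = tw_gamma f l + tw_gamma g l.
Proof.
rewrite /tw_gamma.
have -> : (f + g) (tw_x d l) = f (tw_x d l) + g (tw_x d l) by [].
have -> : (f + g) (tw_y d l) = f (tw_y d l) + g (tw_y d l) by [].
by ring.
Qed.

Lemma tw_gammaZ a f l : tw_gamma (a *: f) l = a * tw_gamma f l.
Proof.
rewrite /tw_gamma.
have -> : (a *: f) (tw_x d l) = a * f (tw_x d l) by [].
have -> : (a *: f) (tw_y d l) = a * f (tw_y d l) by [].
by ring.
Qed.

Lemma tw_gammaB f g l : tw_gamma (f - g) l = tw_gamma f l - tw_gamma g l.
Proof. by rewrite tw_gammaD -(scaleN1r g) tw_gammaZ mulN1r. Qed.

Lemma tw_gamma_le (f : K -> R) l M : (forall x, `|f x| <= M) ->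
  `|tw_gamma f l| <= 2 * M.
Proof.
move=> fM; rewrite normrM (le_trans (ler_piMl _ (tw_c1 d l)))//.
by rewrite (le_trans (ler_normB _ _))// mulr2n mulrDl mul1r lerD.
Qed.

(* [h \o inr] represents, modulo [c0], the image of [h \o inl] under
   [f |-> \sum_l tw_gamma f l *: \1_(tw_A d l)]. *)
Definition twist_pred (h : K + nat -> R) : Prop :=
  [/\ continuous (h \o inl), exists M, forall p, `|h p| <= M,
    forall l (e : R), 0 < e -> \forall s \near \oo, tw_A d l s ->
      `|h (inr s) - tw_gamma (h \o inl) l| <= e &
    forall e : R, 0 < e -> exists2 F : set (tw_index d), finite_set F &
      \forall s \near \oo, (forall l, F l -> ~ tw_A d l s) -> `|h (inr s)| <= e].

Definition twist_fun : {pred (K + nat -> R)} := mem [set h | twist_pred h].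

Lemma twist_fun_submod_closed : submod_closed twist_fun.
Proof.
split=> [|a f g]; rewrite !inE /=.
  split.
  - by move=> x; exact: cvg_cst.
  - by exists 0 => p; rewrite normr0.
  - move=> l e e0; apply: nearW => s _.
    by rewrite /tw_gamma /= subrr mulr0 subr0 normr0 ltW.
  - by move=> e e0; exists set0 => //; apply: nearW => s _; rewrite normr0 ltW.
move=> [cf [Mf fM] f1 f2] [cg [Mg gM] g1 g2]; split.
- by move=> x; apply: cvgD (cg x); apply: cvgZr; exact: cf.
- exists (`|a| * Mf + Mg) => p; rewrite (le_trans (ler_normD _ _))// lerD//.
  by rewrite normrM ler_wpM2l.
- move=> l e e0; have e20 : 0 < e / (2 * (1 + `|a|)).
    by rewrite divr_gt0// mulr_gt0// ltr_pwDl.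
  have e2 : 0 < e / 2 by rewrite divr_gt0.
  have := f1 l _ e20; have := g1 l _ e2; apply: filterS2 => s gs fs As.
  have {}gs := gs As; have {}fs := fs As.
  have -> : tw_gamma ((a *: f + g) \o inl) l =
      a * tw_gamma (f \o inl) l + tw_gamma (g \o inl) l.
    by rewrite -tw_gammaZ -tw_gammaD.
  have -> : (a *: f + g) (inr s) = a * f (inr s) + g (inr s) by [].
  rewrite opprD addrACA -mulrBr (le_trans (ler_normD _ _))// (splitr e) lerD//.
  by rewrite normrM (le_trans (ler_wpM2l _ fs))// mul_half_le// ltW.
move=> e e0; have e20 : 0 < e / (2 * (1 + `|a|)).
  by rewrite divr_gt0// mulr_gt0// ltr_pwDl.
have e2 : 0 < e / 2 by rewrite divr_gt0.
have [F finF fF] := f2 _ e20; have [G finG gG] := g2 _ e2.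
exists (F `|` G); first by rewrite finite_setU.
apply: filterS2 fF gG => s fs gs FGs.
have {}fs := fs (fun l Fl => FGs l (or_introl Fl)).
have {}gs := gs (fun l Fl => FGs l (or_intror Fl)).
have -> : (a *: f + g) (inr s) = a * f (inr s) + g (inr s) by [].
rewrite (le_trans (ler_normD _ _))// (splitr e) lerD//.
by rewrite normrM (le_trans (ler_wpM2l _ fs))// mul_half_le// ltW.
Qed.

HB.instance Definition _ :=
  GRing.isSubmodClosed.Build R (K + nat -> R) twist_fun twist_fun_submod_closed.

Record twist_space := TwistSpace {
  twist_val :> K + nat -> R ;
  twist_valP : twist_val \in twist_fun }.

HB.instance Definition _ := [isSub of twist_space for twist_val].
HB.instance Definition _ := [Choice of twist_space by <:].
HB.instance Definition _ := [SubChoice_isSubLmodule of twist_space by <:].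

Implicit Types f g : twist_space.

Lemma twistP f : twist_pred f.
Proof. by have := twist_valP f; rewrite inE. Qed.

Lemma twist_bounded f : has_ubound (range (fun x => `|f x|)).
Proof. by have [_ [M fM] _ _] := twistP f; exists M => _ [p _ <-]. Qed.

Definition twist_norm f : R := sup_norm f.

Lemma twist_normD f g : twist_norm (f + g) <= twist_norm f + twist_norm g.
Proof. exact: sup_normD (twist_bounded f) (twist_bounded g). Qed.

Lemma twist_normZ (l : R) f : twist_norm (l *: f) = `|l| * twist_norm f.
Proof. exact: sup_normZ (twist_bounded f). Qed.

Lemma twist_norm0_eq0 f : twist_norm f = 0 -> f = 0.
Proof. by move=> /(sup_norm0_eq0 (twist_bounded f)) f0; exact: val_inj. Qed.

HB.instance Definition _ :=
  Lmodule_isNormed.Build R twist_space twist_normD twist_normZ twist_norm0_eq0.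

Lemma twist_complete (F : set_system twist_space) :
  ProperFilter F -> cauchy F -> cvg F.
Proof.
move: F; apply: (@sup_norm_complete _ _ twist_space twist_val).
- by [].
- by move=> f x; exact: sup_norm_ub (twist_bounded f).
- by move=> f M; exact: sup_norm_le.
move=> h hlim.
have ch : h \in twist_fun; last by exists (TwistSpace h ch).
rewrite inE /=; split.
- move=> x; apply/cvgrPdist_le => e e0.
  have e30 : 0 < e / 3 by rewrite divr_gt0.
  have [f hf] := hlim _ e30; have [cf _ _ _] := twistP f.
  have /cvgrPdist_le /(_ _ e30) := cf x; apply: filterS => y fxy.
  have := hf (inl x); have := hf (inl y); move: fxy => /=.
  by rewrite !ler_norml; lra.
- have [f hf] := hlim _ ltr01; have [_ [M fM] _ _] := twistP f.
  by exists (1 + M) => p; have := hf p; have := fM p; rewrite !ler_norml; lra.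
(* One quarter of [e] is spent at [inr s], one on the clause for [f], and two on [tw_gamma], which
   at most doubles the uniform distance. *)
- move=> l e e0; have e40 : 0 < e / 4 by rewrite divr_gt0.
  have [f hf] := hlim _ e40; have [_ _ f1 _] := twistP f.
  have := f1 l _ e40; apply: filterS => s fs As; have {}fs := fs As.
  have hg : `|tw_gamma (h \o inl) l - tw_gamma (f \o inl) l| <= 2 * (e / 4).
    rewrite -tw_gammaB; apply: tw_gamma_le => x; exact: hf (inl x).
  by have := hf (inr s); move: fs hg; rewrite !ler_norml; lra.
move=> e e0; have e20 : 0 < e / 2 by rewrite divr_gt0.
have [f hf] := hlim _ e20; have [_ _ _ f2] := twistP f.
have [G finG fG] := f2 _ e20; exists G => //.
apply: filterS fG => s fs Gs; have {}fs := fs Gs.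
by have := hf (inr s); move: fs; rewrite !ler_norml; lra.
Qed.

HB.instance Definition _ := Uniform_isComplete.Build twist_space twist_complete.

End twist_space.

Lemma near_finite_set {T U : Type} (G : set_system U) (F : set T)
    (P : T -> U -> Prop) : Filter G -> finite_set F ->
  (forall l, F l -> \forall s \near G, P l s) ->
  \forall s \near G, forall l, F l -> P l s.
Proof.
move=> FG finF FP.
have := @filter_bigI U {classic T} (fset_set (F : set {classic T})) P G FG.
rewrite fset_setK// => FPG; apply: filterS (FPG _) => [s Ps l Fl|l].
  exact: (Ps l Fl).
by rewrite in_fset_set// inE; exact: FP.
Qed.

Section twisted_sum.
Context {R : realType} {K : topologicalType} (cK : compact [set: K]).
Context (d : twist_data R K).

Definition twist_inj_fun (u : c0_space R) (p : K + nat) : R :=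
  if p is inr s then u s else 0.

Lemma twist_inj_funP (u : c0_space R) : twist_inj_fun u \in twist_fun d.
Proof.
rewrite inE; split=> /=.
- by move=> x; exact: cvg_cst.
- have [M uM] := c0_bounded u; exists (Num.max M 0) => -[x|s] /=.
    by rewrite normr0 le_max lexx orbT.
  by rewrite le_max uM//; exists s.
- move=> l e e0; have /cvgrPdist_le/(_ _ e0) := c0_cvg u.
  apply: filterS => s; rewrite sub0r normrN /tw_gamma /= subrr mulr0 subr0.
  by [].
move=> e e0; exists set0 => //; have /cvgrPdist_le/(_ _ e0) := c0_cvg u.
by apply: filterS => s; rewrite sub0r normrN.
Qed.

Definition twist_inj (u : c0_space R) : twist_space d :=
  TwistSpace d (twist_inj_fun u) (twist_inj_funP u).

Lemma twist_inj_linear : linear twist_inj.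
Proof.
move=> a u v; apply: val_inj; apply/funext => -[x|s] //.
by apply: (@eq_trans _ _ (a * 0 + 0)) => //; rewrite mulr0 addr0.
Qed.

HB.instance Definition _ := GRing.isLinear.Build R (c0_space R) (twist_space d)
  *:%R twist_inj twist_inj_linear.

Lemma twist_proj_funP (h : twist_space d) : twist_val d h \o inl \in @cont_fun R K.
Proof. by rewrite inE; have [] := twistP d h. Qed.

Definition twist_proj (h : twist_space d) : C_space R cK :=
  CSpace cK (twist_proj_funP h).

Lemma twist_proj_linear : linear twist_proj.
Proof. by move=> a u v; exact: val_inj. Qed.

HB.instance Definition _ := GRing.isLinear.Build R (twist_space d) (C_space R cK)
  *:%R twist_proj twist_proj_linear.

Lemma contraction_bounded (V W : normedModType R) (f : {linear V -> W}) :
  (forall x, `|f x| <= `|x|) -> bounded_near f (nbhs 0).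
Proof.
move=> f1; apply/linear_boundedP; near=> r => x.
rewrite (le_trans (f1 x))// ler_peMl//.
Unshelve. all: by end_near. Qed.

Lemma twist_inj_bounded : bounded_near twist_inj (nbhs 0).
Proof.
apply: contraction_bounded => u.
apply: sup_norm_le => [|[x|s]] //=; first by rewrite normr0.
exact: sup_norm_ub (c0_bounded u).
Qed.

Lemma twist_proj_bounded : bounded_near twist_proj (nbhs 0).
Proof.
apply: contraction_bounded => h; apply: sup_norm_le => // x.
exact: sup_norm_ub (twist_bounded d h).
Qed.

Lemma twist_inj_inj : injective twist_inj.
Proof.
move=> u v uv; apply: val_inj; apply/funext => s.
by have /(congr1 (fun h : twist_space d => h (inr s))) := uv.
Qed.

(** Outside finitely many of the sets [tw_A d l] the last clause of [twist_pred] makes [h] small;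
    along each of these the third clause does, because [tw_gamma] vanishes on the zero function. *)
Lemma twist_kernel (h : twist_space d) : twist_proj h = 0 ->
  exists u, twist_inj u = h.
Proof.
move=> h0; have {}h0 x : h (inl x) = 0.
  by have /(congr1 (fun f : C_space R cK => f x)) := h0.
have [_ _ h1 h2] := twistP d h.
have uP : (fun s => h (inr s)) \in @null_seq R.
  rewrite inE; apply/cvgrPdist_le => e e0; have [F finF Fe] := h2 _ e0.
  have Fn : \forall s \near \oo, forall l, F l -> tw_A d l s -> `|h (inr s)| <= e.
    apply: near_finite_set => // l Fl.
    have := h1 l _ e0; apply: filterS => s hs As; have := hs As.
    by rewrite /tw_gamma /= !h0 subrr mulr0 subr0.
  apply: filterS2 Fe Fn => s Fe Fn; rewrite sub0r normrN.
  have [[l [Fl As]]|nl] := pselect (exists l, F l /\ tw_A d l s); first exact: (Fn l).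
  by apply: Fe => l Fl As; apply: nl; exists l.
exists (C0Space uP); apply: val_inj; apply/funext => -[x|s] //=.
Qed.

Hypothesis Aad : forall l l' : tw_index d, l <> l' ->
  \forall s \near \oo, ~ (tw_A d l s /\ tw_A d l' s).
Hypothesis null : forall f : K -> R, continuous f -> forall e : R, 0 < e ->
  finite_set [set l | e <= `|tw_gamma d f l|].

(** Where several sets [tw_A d l] meet at [s], the lift takes a value [g l] of at least half the
    supremal size there. Along [tw_A d l] a competing value thus has size at least half that of
    [g l], so by [null] it comes from finitely many indices, whose sets almost miss [tw_A d l]. *)
Lemma twist_surj (f : K -> R) (M : R) : continuous f -> 0 <= M ->
  (forall x, `|f x| <= M) ->
  exists h : twist_space d, h \o inl = f /\ forall p, `|h p| <= 2 * M.
Proof.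
move=> cf M0 fM; pose g := tw_gamma d f.
have gM l : `|g l| <= 2 * M by exact: tw_gamma_le.
have /choice[u uP] : forall s, exists v,
    (forall l, tw_A d l s -> `|g l| <= 2 * `|v|) /\
    (v = 0 \/ exists2 l, tw_A d l s & v = g l).
  move=> s; pose S := [set `|g l| | l in [set l | tw_A d l s]].
  have [[l0 [As0 gl0]]|] := pselect (exists l, tw_A d l s /\ g l <> 0); last first.
    move=> /forallNP nl; exists 0; split; last by left.
    move=> l As; rewrite normr0 mulr0 normr_le0; apply/negPn/negP => /eqP gl.
    by apply: (nl l).
  have hS : has_sup S.
    split; first by exists `|g l0|, l0.
    by exists (2 * M) => _ [l _ <-].
  have S0 : 0 < sup S.
    apply: (@lt_le_trans _ _ `|g l0|); first by rewrite normr_gt0; exact/eqP.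
    by apply: (ub_le_sup hS.2); exists l0.
  have [_ [l As <-] lS] := sup_adherent (divr_gt0 S0 (ltr0n R 2)) hS.
  exists (g l); split; last by right; exists l.
  move=> l' As'; have : `|g l'| <= sup S by apply: (ub_le_sup hS.2); exists l'.
  lra.
pose h (p : K + nat) : R := match p with inl x => f x | inr s => u s end.
have hg : tw_gamma d (h \o inl) = g by [].
have hP : h \in twist_fun d.
  rewrite inE; split=> //.
  - exists (2 * M) => -[x|s] /=; first by rewrite (le_trans (fM x))// mulr2n mulrDl mul1r lerDl.
    have [_ [->|[l _ ->]]] := uP s => //.
    by rewrite normr0 mulr_ge0.
  - move=> l e e0; rewrite hg /=.
    (* If [g l] is zero, only competing values of size at least [e] can do harm, and these are again
       finitely many. *)
    pose a := if g l == 0 then e else `|g l| / 2.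
    have a0 : 0 < a.
      by rewrite /a; case: eqVneq => // gl0; rewrite divr_gt0 ?normr_gt0.
    have finF : finite_set [set l' | l <> l' /\ a <= `|g l'|].
      by apply: sub_finite_set (null f cf a a0) => l' [].
    have : \forall s \near \oo, forall l', l <> l' /\ a <= `|g l'| ->
        ~ (tw_A d l s /\ tw_A d l' s).
      by apply: near_finite_set finF _ => l' [ll' _]; exact: Aad.
    apply: filterS => s Fs As.
    have [ul ugl] := uP s; have {}ul := ul _ As.
    have [uE|neq] := eqVneq (u s) (g l); first by rewrite uE subrr normr0 ltW.
    have lt_a : `|u s| < a.
      rewrite ltNge; apply/negP => au; case: ugl => [u0|[l' As' ul']].
        by move: au; rewrite u0 normr0 leNgt a0.
      apply: (Fs l') (conj As As'); rewrite -ul'; split=> // ll'.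
      by move/eqP: neq; rewrite ul' ll'.
    move: lt_a; rewrite /a; case: eqVneq => [->|gl0]; first by rewrite subr0 => /ltW.
    by move: ul; lra.
  move=> e e0; exists [set l | e <= `|g l|]; first exact: null.
  apply: nearW => s Fs /=; have [_ [->|[l As ->]]] := uP s.
    by rewrite normr0 ltW.
  by rewrite leNgt; apply/negP => /ltW/Fs.
exists (TwistSpace d h hP); split=> // -[x|s] /=.
  by rewrite (le_trans (fM x))// mulr2n mulrDl mul1r lerDl.
have [_ [->|[l _ ->]]] := uP s => //.
by rewrite normr0 mulr_ge0.
Qed.

Lemma twist_exactm : range twist_inj = twist_proj @^-1` [set 0].
Proof.
apply/seteqP; split=> [_ [u _ <-]|h /= /twist_kernel[u uh]]; last by exists u.
by apply: val_inj; apply/funext.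
Qed.

Lemma twist_exactr : range twist_proj = setT.
Proof.
apply/seteqP; split=> // f _.
have [|h [hf _]] := twist_surj f `|f| (@C_continuous _ _ _ f) (normr_ge0 f).
  by move=> x; exact: sup_norm_ub (C_bounded f).
by exists h => //; apply: val_inj.
Qed.

Definition twist_sum : twisted_sum (c0_space R) (C_space R cK) :=
  @TwistedSum R (c0_space R) (C_space R cK) (twist_space d) twist_inj twist_proj
    twist_inj_bounded twist_proj_bounded twist_inj_inj twist_exactm twist_exactr.

(* A retraction [r] onto [c0] gives [nu s f = h (inr s) - r h s], which does not
   depend on the preimage [h] of [f]. *)
Lemma twist_sum_lift : trivial_twisted_sum twist_sum ->
  exists (nu : nat -> C_space R cK -> R) (C : R), [/\
    forall s (a : R) (f g : C_space R cK), nu s (a *: f + g) = a * nu s f + nu s g,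
    forall s (f : C_space R cK) (M : R), 0 <= M -> (forall x, `|f x| <= M) -> `|nu s f| <= C * M &
    forall l (f : C_space R cK) (e : R), 0 < e -> \forall s \near \oo, tw_A d l s ->
      `|nu s f - tw_gamma d f l| <= e].
Proof.
move=> [r [/linear_boundedP/pinfty_ex_gt0[C C0 rC] rK]].
have /choice[h hP] : forall f : C_space R cK, exists h : twist_space d,
    twist_proj h = f /\
    forall M : R, 0 <= M -> (forall x, `|f x| <= M) -> forall p, `|h p| <= 2 * M.
  move=> f.
  have [|h [hf hM]] := twist_surj f `|f| (@C_continuous _ _ _ f) (normr_ge0 f).
    by move=> x; exact: sup_norm_ub (C_bounded f).
  exists h; split=> [|M M0 fM p]; first exact: val_inj.
  by rewrite (le_trans (hM p))// ler_pM2l//; exact: sup_norm_le.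
have wd (k : twist_space d) s : twist_proj k = 0 -> k (inr s) - r k s = 0.
  by move=> /twist_kernel[u <-]; rewrite rK subrr.
(* The chosen preimage doubles the bound of [f], and [r] multiplies norms by at most [C]. *)
exists (fun s f => h f (inr s) - r (h f) s), ((1 + C) * 2); split.
- move=> s a f g; apply/eqP; rewrite -subr_eq0; apply/eqP.
  pose k : twist_space d := h (a *: f + g) - (a *: h f + h g).
  have k0 : twist_proj k = 0.
    have -> : twist_proj k =
      twist_proj (h (a *: f + g)) - (a *: twist_proj (h f) + twist_proj (h g)).
      exact: val_inj.
    by rewrite (hP _).1 (hP f).1 (hP g).1 subrr.
  have := wd k s k0.
  have -> : k (inr s) = h (a *: f + g) (inr s) - (a * h f (inr s) + h g (inr s)).
    by [].
  have -> : r k s = r (h (a *: f + g)) s - (a * r (h f) s + r (h g) s).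
    by rewrite linearB (linearP r).
  by move=> <-; ring.
- move=> s f M M0 fM; have [_ /(_ _ M0 fM) hM] := hP f.
  have nh : `|h f| <= 2 * M by apply: sup_norm_le => //; rewrite mulr_ge0.
  rewrite (le_trans (ler_normB _ _))// -mulrA mulrDl mul1r lerD//.
  rewrite (le_trans (sup_norm_ub _ (c0_bounded _)))//.
  by rewrite (le_trans (rC _))// ler_pM2l.
move=> l f e e0; have [hf _] := hP f.
have [_ _ h1 _] := twistP d (h f).
have e20 : 0 < e / 2 by rewrite divr_gt0.
have /cvgrPdist_le/(_ _ e20) := c0_cvg (r (h f)).
have := h1 l _ e20; apply: filterS2 => s hs rs As; have {}hs := hs As.
have hfE : twist_val d (h f) \o inl = f by rewrite -[in RHS]hf.
by move: hs rs; rewrite hfE !ler_norml; lra.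
Qed.

Lemma twist_Ext : ~ trivial_twisted_sum twist_sum ->
  Ext_neq0 (C_space R cK) (c0_space R).
Proof. by exists twist_sum. Qed.

End twisted_sum.

(** * Almost disjoint branches and test functions with disjoint supports *)

Definition branch (l : nat -> bool) : set nat :=
  [set pickle (mkseq l n) | n in [set: nat]].

Lemma branch_infinite l N : exists2 s, branch l s & (N < s)%N.
Proof.
have inj : injective (fun n => pickle (mkseq l n)).
  by move=> m n /(pcan_inj pickleK)/(congr1 size); rewrite !size_mkseq.
by have [n Nn] := injective_gtn inj N; exists (pickle (mkseq l n)) => //; exists n.
Qed.

(** Initial segments longer than a place [k] of disagreement are distinct, so a common code comes
    from one of the finitely many lengths up to [k]. The branches of the binary tree are thus an
    almost disjoint family of size continuum. *)
Lemma branch_disjoint l l' : l <> l' ->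
  \forall s \near \oo, ~ (branch l s /\ branch l' s).
Proof.
move=> ll'; have [k lk] : exists k, l k <> l' k.
  by apply/existsNP => ll; apply: ll'; apply/funext.
have finF : finite_set [set pickle (mkseq l n) | n in `I_k.+1].
  exact: finite_image.
have : \forall s \near \oo, forall t, [set pickle (mkseq l n) | n in `I_k.+1] t ->
    (t < s)%N.
  by apply: near_finite_set finF _ => t _; exact: nbhs_infty_gt.
apply: filterS => s Fs [[n _ ns] [m _ ms]].
have := Fs s; rewrite ltnn => Fs'; suff : false by []; apply: Fs'.
exists n => //=; rewrite ltnS leqNgt; apply/negP => kn; apply: lk.
have /(pcan_inj pickleK) nm : pickle (mkseq l n) = pickle (mkseq l' m).
  by rewrite ns ms.
have /(congr1 size) := nm; rewrite !size_mkseq => mn.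
by have := congr1 (nth false ^~ k) nm; rewrite !nth_mkseq// -mn.
Qed.

Lemma harmonic_sum_unbounded {R : realType} (C : R) :
  exists N, C < \sum_(i < N) i.+1%:R^-1.
Proof.
apply: contrapT => /forallNP nC; apply: (@dvg_harmonic R).
apply: nondecreasing_is_cvgn.
  apply/nondecreasing_seqP => n; rewrite /series /= big_nat_recr//= lerDl.
  by rewrite /harmonic invr_ge0.
exists C => _ [N _ <-]; rewrite leNgt; apply/negP => CN; apply: (nC N).
by move: CN; rewrite /series /= big_mkord.
Qed.

Lemma urysohn_point {R : realType} {K : topologicalType} (W : set K) (x y : K) :
  compact [set: K] -> hausdorff_space K -> open W -> W x -> x <> y ->
  exists f : K -> R, [/\ continuous f, f x = 1, f y = 0,
    forall z, 0 <= f z <= 1 & forall z, ~ W z -> f z = 0].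
Proof.
move=> cK hK oW Wx xy.
have nK : normal_space K := compact_normal hK cK.
have cl1 (z : K) : closed [set z].
  exact: accessible_closed_set1 (hausdorff_accessible hK) z.
(* The point [y] is added because it may lie in [W]. *)
have cA : closed (~` W `|` [set y]) by apply: closedU => //; exact: open_closedC.
have dAB : (~` W `|` [set y]) `&` [set x] = set0.
  by apply/seteqP; split=> // z [[nWz|->] /= zx]; [apply: nWz; rewrite zx|apply: xy].
have /(@uniform_separatorP _ R)[f [cf f01 f0 f1]] :=
  (@normal_separatorP R K).1 nK _ _ cA (cl1 x) dAB.
exists f; split=> //.
- by apply: f1; exists x.
- by apply: f0; exists y => //; right.
- by move=> z; have := f01 (f z) (imageT _ _); rewrite /= in_itv.
- by move=> z nWz; apply: f0; exists z => //; left.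
Qed.

Section disjoint_sum.
Context {R : realType} {K : topologicalType} (cK : compact [set: K]).
Variables (nu : C_space R cK -> R) (C : R).
Hypothesis nu_lin : forall (a : R) (f g : C_space R cK),
  nu (a *: f + g) = a * nu f + nu g.
Hypothesis nu_bd : forall (f : C_space R cK) (M : R), 0 <= M ->
  (forall x, `|f x| <= M) -> `|nu f| <= C * M.

(** Evaluate [nu] at the sum of the [f i] weighted by the signs of [nu (f i)]; disjointness of the
    supports keeps this sum between -1 and 1. *)
Lemma disjoint_sum_le (f : nat -> C_space R cK) (m : nat) :
  (forall i x, (i < m)%N -> `|f i x| <= 1) ->
  (forall i j x, (i < j < m)%N -> f i x = 0 \/ f j x = 0) ->
  \sum_(i < m) `|nu (f i)| <= C.
Proof.
move=> f1 fd.
(* The third clause carries the induction: it makes the partial sum vanish wherever the next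
   function does not. *)
have [g [gnu g1 _]] : exists g : C_space R cK,
    [/\ nu g = \sum_(i < m) `|nu (f i)|, forall x, `|g x| <= 1 &
      forall x, (forall i, (i < m)%N -> f i x = 0) -> g x = 0].
  elim: m f1 fd => [|m IH] f1 fd.
    exists 0; split=> // [|x]; last by rewrite normr0.
    rewrite big_ord0; have := nu_lin 0 0 0; rewrite scale0r add0r mul0r add0r.
    by have := nu_lin 1 0 0; rewrite scaler0 add0r mul1r; lra.
  have [|i j x /andP[ij jm]|g [gnu g1 g0]] := IH.
  - by move=> i x im; apply: f1; rewrite ltnS ltnW.
  - by apply: fd; rewrite ij ltnS ltnW.
  exists (Num.sg (nu (f m)) *: f m + g); split.
  - by rewrite nu_lin gnu big_ord_recr/= addrC -normrEsg.
  - move=> x; have [fx|fx] := eqVneq (f m x) 0.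
      have -> : (Num.sg (nu (f m)) *: f m + g) x = Num.sg (nu (f m)) * f m x + g x.
        by [].
      by rewrite fx mulr0 add0r.
    have gx : g x = 0.
      apply: g0 => i im; have [|//|] := fd i m x; first by rewrite im ltnSn.
      by move=> fx0; move: fx; rewrite fx0 eqxx.
    have -> : (Num.sg (nu (f m)) *: f m + g) x = Num.sg (nu (f m)) * f m x + g x.
      by [].
    rewrite gx addr0 normrM mulr_ile1// ?f1//.
    by rewrite normr_sg lern1 leq_b1.
  move=> x fx0.
  have -> : (Num.sg (nu (f m)) *: f m + g) x = Num.sg (nu (f m)) * f m x + g x.
    by [].
  rewrite fx0// mulr0 add0r g0// => i im; apply: fx0; exact: ltnW.
rewrite -gnu -[C]mulr1 (le_trans (ler_norm _))//; exact: nu_bd.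
Qed.

End disjoint_sum.

(** * Two criteria for non-triviality *)

(** In other words, the differences of point masses define an operator from [C(K)] to [c0(L)]. *)
Definition null_pairs (R : realType) {K : topologicalType} {L : Type}
    (x y : L -> K) : Prop :=
  forall f : K -> R, continuous f -> forall e : R, 0 < e ->
    finite_set [set l | e <= `|f (x l) - f (y l)|].

Lemma half_le_norm {R : realType} (a b : R) : `|a - b| <= b / 2 -> b / 2 <= `|a|.
Proof. by move=> ab; apply: le_trans (ler_norm _); move: ab; rewrite ler_norml; lra. Qed.

Section Ext_criteria.
Context {R : realType} {K : topologicalType} (cK : compact [set: K]).
Hypothesis hK : hausdorff_space K.

(** Take all coefficients equal to 1 and a bump [f l] in each [W l]. Every [f l] is detected by some
    [nu s], while a bounded [nu s] detects only finitely many disjoint bumps, so [L] would be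
    countable. The codes [c] assign distinct branches to the indices. *)
Lemma Ext_uncountable_disjoint {L : Type} (c : L -> nat -> bool)
    (W : L -> set K) (x y : L -> K) :
  injective c -> ~ countable [set: L] ->
  (forall l, open (W l)) -> (forall l l' z, W l z -> W l' z -> l = l') ->
  (forall l, W l (x l)) -> (forall l, x l <> y l) -> null_pairs R x y ->
  Ext_neq0 (C_space R cK) (c0_space R).
Proof.
move=> cinj unc oW dW Wx xy nxy.
have c1 (l : L) : `|1 : R| <= 1 by rewrite normr1.
pose d := TwistData R K L (branch \o c) x y (fun=> 1) c1.
have gE f l : tw_gamma d f l = f (x l) - f (y l) by rewrite /tw_gamma mul1r.
have Aad (l l' : tw_index d) : l <> l' ->
    \forall s \near \oo, ~ (tw_A d l s /\ tw_A d l' s).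
  by move=> ll'; apply: branch_disjoint => /cinj.
have null (f : K -> R) : continuous f -> forall e : R, 0 < e ->
    finite_set [set l | e <= `|tw_gamma d f l|].
  move=> cf e e0; rewrite (_ : [set l | _] = [set l | e <= `|f (x l) - f (y l)|]).
    exact: nxy.
  by apply/funext => l /=; rewrite gE.
apply: (twist_Ext cK d Aad null) => /twist_sum_lift[nu [C [nu_lin nu_bd nu_lim]]].
have /choice[f fP] : forall l, exists f : C_space R cK, [/\ f (x l) = 1,
    f (y l) = 0, forall z, `|f z| <= 1 & forall z, ~ W l z -> f z = 0].
  move=> l.
  have [f [cf fx fy f01 fW]] := @urysohn_point R K _ _ _ cK hK (oW l) (Wx l) (xy l).
  have cf' : f \in @cont_fun R K by rewrite inE.
  by exists (CSpace cK cf'); split=> // z; have /andP[? ?] := f01 z; rewrite ger0_norm.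
apply: unc; pose B s := [set l | 1 / 2 <= `|nu s (f l)|].
have -> : [set: L] = \bigcup_s B s.
  apply/seteqP; split=> // l _; have e0 : 0 < 1 / 2 :> R by rewrite divr_gt0.
  have [N _ NP] := nu_lim l (f l) _ e0.
  have [s As Ns] := branch_infinite (c l) N; exists s => //.
  have := NP s (ltnW Ns) As; rewrite gE; have [-> -> _ _] := fP l.
  by rewrite subr0; exact: half_le_norm.
apply: bigcup_countable => // s _; apply: finite_set_countable.
apply: contrapT => /infiniteP Binf.
have [l0 _] := infinite_setN0 ((infiniteP _).2 Binf).
have [i [iB iinj]] := card_le_injfun l0 _ _ Binf.
(* More than [2 * C] bumps, each contributing at least [1 / 2], exceed the bound [C]. *)
pose m := Num.bound `|2 * C|.
have : \sum_(k < m) `|nu s (f (i k))| <= C.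
  apply: (disjoint_sum_le cK (nu s) C (nu_lin s) (nu_bd s) (f \o i)).
    by move=> k z _; have [_ _ + _] := fP (i k); apply.
  move=> j k z /andP[jk _]; have [_ _ _ fj] := fP (i j); have [_ _ _ fk] := fP (i k).
  have [Wj|/fj] := pselect (W (i j) z); last by left.
  right; apply: fk => Wk; have /iinj jk' := dW _ _ _ Wj Wk.
  by move: jk; rewrite jk' ?ltnn.
have : \sum_(k < m) 1 / 2 <= \sum_(k < m) `|nu s (f (i k))|.
  by apply: ler_sum => k _; exact: iB.
rewrite sumr_const card_ord -mulr_natr.
have : 2 * C < m%:R.
  by rewrite (le_lt_trans (ler_norm _))//; exact: archi_boundP (normr_ge0 _).
by move: (\sum_(k < m) _) => S h1 h2 h3; clear -h1 h2 h3; lra.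
Qed.

(* Each [nu s] is small on all but a few of the [U n], in a sense made precise by
   the divergence of the harmonic series.  An index [l] encodes the candidates
   [slice l n] for the set of those [s] for which [nu s] is not small on [U n]. *)
Lemma Ext_disjoint_sequence (U : nat -> set K) (x y : nat -> (nat -> bool) -> K) :
  (forall n, open (U n)) -> (forall m n z, U m z -> U n z -> m = n) ->
  (forall n l, U n (x n l)) -> (forall n l, x n l <> y n l) ->
  (forall n, null_pairs R (x n) (y n)) ->
  Ext_neq0 (C_space R cK) (c0_space R).
Proof.
move=> oU dU Ux xy nxy.
(* [k l] is a position whose slice fails to contain almost all of [branch l], if such a position
   exists; the pair attached to [l] is then taken in [U (k l)]. *)
have /choice[k kP] : forall l, exists n : nat,
    (\forall s \near \oo, branch l s -> slice l n s) ->
    forall m, \forall s \near \oo, branch l s -> slice l m s.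
  move=> l; apply: contrapT => /forallNP h; apply: (h 0%N) => _ m.
  by apply: contrapT => nm; apply: (h m).
pose w (l : nat -> bool) : R := (k l).+1%:R^-1.
have w1 l : `|w l| <= 1.
  by rewrite /w ger0_norm ?invr_ge0// invf_le1 ?ltr0n// ler1n.
pose d := TwistData R K _ branch (fun l => x (k l) l) (fun l => y (k l) l) w w1.
have gE f l : tw_gamma d f l = w l * (f (x (k l) l) - f (y (k l) l)) by [].
have Aad (l l' : tw_index d) : l <> l' ->
    \forall s \near \oo, ~ (tw_A d l s /\ tw_A d l' s) by exact: branch_disjoint.
have null (f : K -> R) : continuous f -> forall e : R, 0 < e ->
    finite_set [set l | e <= `|tw_gamma d f l|].
  move=> cf e e0; have cf' : f \in @cont_fun R K by rewrite inE.
  have [M fM] := C_bounded (CSpace cK cf').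
  have {}fM z : `|f z| <= M by apply: fM; exists z.
  (* For [k l] at least [N] the weight alone brings [tw_gamma] below [e], so finitely many of the
     null families remain. *)
  pose N := Num.bound `|2 * M / e|.
  apply: (@sub_finite_set _ _
    (\bigcup_(n in `I_N) [set l | e <= `|f (x n l) - f (y n l)|])).
    move=> l /=; rewrite gE normrM (ger0_norm (_ : 0 <= w l)) ?invr_ge0// => el.
    have fle : `|f (x (k l) l) - f (y (k l) l)| <= 2 * M.
      by rewrite (le_trans (ler_normB _ _))// mulr2n mulrDl mul1r lerD.
    exists (k l) => /=.
      rewrite ltnNge; apply/negP => Nk.
      have : 2 * M / e < N%:R.
        by rewrite (le_lt_trans (ler_norm _))//; exact: archi_boundP (normr_ge0 _).
      rewrite ltr_pdivrMr// => MN.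
      move: el; rewrite /w mulrC ler_pdivlMr ?ltr0n// => el.
      have : e * N%:R <= e * (k l).+1%:R by rewrite ler_pM2l// ler_nat ltnW.
      move: MN; rewrite mulrC; lra.
    by rewrite (le_trans el)// ler_piMl// (le_trans (ler_norm _)).
  apply: bigcup_finite => // n _; exact: nxy.
apply: (twist_Ext cK d Aad null) => /twist_sum_lift[nu [C [nu_lin nu_bd nu_lim]]].
(* [M n] collects the [s] for which [nu s] is large on [U n], the threshold being half the weight
   used there. *)
pose M n s := `[< exists f : C_space R cK, [/\ forall z, `|f z| <= 1,
  forall z, ~ U n z -> f z = 0 & n.+1%:R^-1 / 2 <= `|nu s f| ] >].
have [l lM] := exists_slice M.
(* For the index [l] that codes [M], a bump at its own pair shows that slice [k l] contains almost
   all of the branch. By the choice of [k l], every slice does. *)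
have Ml : \forall s \near \oo, branch l s -> slice l (k l) s.
  have [f [cf fx fy f01 fW]] :=
    @urysohn_point R K _ _ _ cK hK (oU (k l)) (Ux _ l) (xy _ l).
  have cf' : f \in @cont_fun R K by rewrite inE.
  have w0 : 0 < w l / 2 by rewrite divr_gt0// invr_gt0.
  have := nu_lim l (CSpace cK cf') _ w0; apply: filterS => s h As.
  have {h} := h As; rewrite gE /= fx fy subr0 mulr1 => h.
  rewrite lM; apply/asboolP; exists (CSpace cK cf'); split=> //.
    by move=> z /=; have /andP[? ?] := f01 z; rewrite ger0_norm.
  exact: half_le_norm.
have {}Ml := kP l Ml.
have [N CN] := harmonic_sum_unbounded (2 * C).
have : \forall s \near \oo, forall n, `I_N n -> branch l s -> slice l n s.
  by apply: near_finite_set => // n _; exact: Ml.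
(* A single [s] far along the branch lies in [M n] for all [n < N]; the resulting disjoint functions
   add up to at least half a harmonic sum, which exceeds [C]. *)
move=> [S _ SP]; have [s As Ss] := branch_infinite l S.
have Ms n : (n < N)%N -> M n s by move=> nN; rewrite -lM; exact: (SP s (ltnW Ss)).
have /choice[f fP] : forall n, exists f : C_space R cK, (n < N)%N ->
    [/\ forall z, `|f z| <= 1, forall z, ~ U n z -> f z = 0 &
      n.+1%:R^-1 / 2 <= `|nu s f| ].
  move=> n; have [/Ms/asboolP[f fP]|nN] := boolP (n < N)%N; first by exists f.
  by exists 0.
have : \sum_(n < N) `|nu s (f n)| <= C.
  apply: (disjoint_sum_le cK (nu s) C (nu_lin s) (nu_bd s) f).
    by move=> n z /fP[+ _ _]; apply.
  move=> m n z /andP[mn nN]; have [_ fm _] := fP m (ltn_trans mn nN).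
  have [_ fn _] := fP n nN.
  have [Um|/fm] := pselect (U m z); last by left.
  right; apply: fn => Un; have mn' := dU _ _ _ Um Un.
  by move: mn; rewrite mn' ltnn.
have : \sum_(n < N) n.+1%:R^-1 / 2 <= \sum_(n < N) `|nu s (f n)|.
  by apply: ler_sum => n _; have [_ _] := fP n (ltn_ord n).
rewrite -mulr_suml; lra.
Qed.

End Ext_criteria.

(** * Coordinates on Corson compacta *)

Lemma small_bigcup_index {T U : Type} (D : set T) (F : T -> set U) :
  countable D -> (forall x, D x -> small (F x)) -> small (\bigcup_(x in D) F x).
Proof.
move=> /countable_injP[e einj] sF.
apply: (@small_sub _ _ (\bigcup_n \bigcup_(x in [set x | D x /\ e x = n]) F x)).
  by move=> u [x Dx Fu]; exists (e x) => //; exists x.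
apply: small_bigcup => n; have [[x [Dx ex]]|nx] := pselect (exists x, D x /\ e x = n).
  apply: (@small_sub _ _ (F x)); last exact: sF.
  move=> u [y [Dy ey] Fu]; suff -> : x = y by [].
  by apply: einj; rewrite ?inE// ex ey.
apply: (@small_sub _ _ set0) => [u [y yP _]|]; first by apply: nx; exists y.
exact/small_countable/countable0.
Qed.

(** Branches can label at most continuum many members. If [Q] embeds into the Cantor set, all of [Q]
    is taken; otherwise a copy of the Cantor set inside [Q]. *)
Lemma uncountable_index {T : Type} (Q : set T) : ~ countable Q ->
  exists (L : Type) (c : L -> nat -> bool) (t : L -> T),
    [/\ injective c, injective t, forall l, Q (t l) & ~ countable [set: L]].
Proof.
move=> ncQ; have [QB|BQ] := card_le_total Q [set: nat -> bool].
  have [c [_ cinj]] := card_le_injfun xpredT _ _ QB.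
  have sinj : injective (@proj1_sig T Q).
    by move=> [s Qs] [t Qt] /= st; subst t; congr exist; exact: Prop_irrelevance.
  exists {x | Q x}, (c \o @proj1_sig T Q), (@proj1_sig T Q); split=> //.
  - by move=> [s Qs] [t Qt] /= /cinj -/(_ Qs Qt) st; apply: sinj.
  - by case.
  move=> cL; apply: ncQ; apply: sub_countable cL.
  apply: card_le_trans (card_image_le (@proj1_sig T Q) _); apply: subset_card_le.
  by move=> q Qq; exists (exist _ q Qq).
have [x0 _] : Q !=set0.
  by apply/set0P/eqP => Q0; apply: ncQ; rewrite Q0; exact: countable0.
have [t [tQ tinj]] := card_le_injfun x0 _ _ BQ.
exists (nat -> bool), id, t; split=> //.
- by move=> l l'; apply: tinj.
- by move=> l; apply: tQ.
by move=> /small_countable sl; apply: sl; exists id; split=> // l l'.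
Qed.

Lemma finite_In {T : Type} (s : seq T) : finite_set [set x | List.In x s].
Proof.
elim: s => [|y s IH]; first by apply: sub_finite_set (finite_set0 T) => x [].
apply: (@sub_finite_set _ _ ([set y] `|` [set x | List.In x s])).
  by move=> x [->|]; [left|right].
by rewrite finite_setU.
Qed.

Lemma compact_subcover {T : topologicalType} {J : Type} (A : set T) (D : set J)
    (V : J -> set T) : compact A -> (forall j, D j -> open (V j)) ->
  (forall x, A x -> exists j, D j /\ V j x) ->
  exists s : seq J, (forall j, List.In j s -> D j) /\
    forall x, A x -> exists j, List.In j s /\ V j x.
Proof.
move=> /compact_near_coveringP cA oV AV.
(* [G] is the filter of lists directed by inclusion; being covered by all large enough lists is then
   a property to which the filter form of compactness applies. *)
pose G : set_system (seq J) := [set P | exists s0 : seq J,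
  (forall j, List.In j s0 -> D j) /\
  forall s, (forall j, List.In j s0 -> List.In j s) -> P s].
have FG : Filter G.
  split=> [|P Q [s [sD sP]] [t [tD tQ]]|P Q PQ [s [sD sP]]].
  - by exists [::].
  - exists (s ++ t); split=> [j /List.in_app_iff[/sD|/tD]//|u stu].
    split; [apply: sP|apply: tQ] => j jst; apply: stu; apply/List.in_app_iff.
      by left.
    by right.
  - by exists s; split=> // u su; apply: PQ; exact: sP.
have [|s [sD sP]] := cA _ G (fun s x => exists j, List.In j s /\ V j x) FG.
  move=> x /AV[j [Dj Vjx]].
  exists (V j, [set s | List.In j s]) => /=.
    split; first by apply: open_nbhs_nbhs; split=> //; exact: oV.
    exists [:: j]; split=> [i [<-|[]]//|u ju]; apply: ju; by left.
  by move=> [x' u] [/= Vx' ju]; exists j.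
by exists s; split=> // x Ax; exact: sP.
Qed.

Section Corson.
Context {R : realType} {K : topologicalType} (cK : compact [set: K]).
Context {I : Type} (phi : K -> I -> R).
Hypothesis phi_cont : forall i, continuous (fun z => phi z i).
Hypothesis phi_inj : forall x y, (forall i, phi x i = phi y i) -> x = y.
Hypothesis phi_supp : forall x, countable [set i | phi x i != 0].

Definition supp (x : K) : set I := [set i | phi x i != 0].
Definition diff_set (x y : K) : set I := [set i | phi x i <> phi y i].

Lemma diff_countable x y : countable (diff_set x y).
Proof.
apply: (@sub_countable _ _ _ (supp x `|` supp y)).
  apply: subset_card_le => i /= xyi; have [x0|x0] := eqVneq (phi x i) 0; last by left.
  by right; apply/eqP => y0; apply: xyi; rewrite x0 y0.
rewrite -bigcup2E; apply: bigcup_countable => // -[|[|n]] _ //=; exact: phi_supp.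
Qed.

Lemma diff_neq0 x y : x <> y -> exists i, diff_set x y i.
Proof. by move=> xy; apply/existsNP => xyE; apply: xy; exact: phi_inj. Qed.

Lemma open_neq0 i : open [set z | phi z i != 0].
Proof.
rewrite (_ : [set z | _] = (fun z => phi z i) @^-1` [set r | r != 0])//.
by apply: open_comp; [move=> z _; exact: phi_cont|exact: open_neq].
Qed.

(* [{(z, w) | e <= |f z - f w|}] is compact and covered by the open sets
   [{(z, w) | phi z i <> phi w i}], each of which contains at most one of the
   pairs. *)
Lemma disjoint_diff_null {L : Type} (x y : L -> K) :
  (forall l l' i, diff_set (x l) (y l) i -> diff_set (x l') (y l') i -> l = l') ->
  null_pairs R x y.
Proof.
move=> dxy f cf e e0.
pose Q := [set p : K * K | e <= `|f p.1 - f p.2|].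
have cQ : compact Q.
  apply: (@subclosed_compact _ _ (setT `*` setT)); last 2 first.
  - exact: compact_setX.
  - by [].
  rewrite (_ : Q = (fun p : K * K => `|f p.1 - f p.2|) @^-1` [set r | e <= r])//.
  apply: closed_comp => [p _|]; last exact: closed_ge.
  apply: cvg_norm; apply: cvgB.
    by apply: (cvg_comp _ f (@cvg_fst _ _ _ _ _)); exact: cf.
  by apply: (cvg_comp _ f (@cvg_snd _ _ _ _ _)); exact: cf.
have oD i : [set: I] i -> open [set p : K * K | phi p.1 i != phi p.2 i].
  move=> _; rewrite (_ : [set p | _] =
    (fun p : K * K => phi p.1 i - phi p.2 i) @^-1` [set r | r != 0]); last first.
    by apply/funext => p /=; rewrite subr_eq0.
  apply: open_comp => [p _|]; last exact: open_neq.
  apply: cvgB.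
    by apply: (cvg_comp _ (phi ^~ i) (@cvg_fst _ _ _ _ _)); exact: phi_cont.
  by apply: (cvg_comp _ (phi ^~ i) (@cvg_snd _ _ _ _ _)); exact: phi_cont.
have [|s [_ Qs]] := compact_subcover _ _ _ cQ oD.
  move=> [z w] /= ezw; have zw : z <> w.
    by move=> zw; move: ezw; rewrite /Q /= zw subrr normr0 leNgt e0.
  by have [i zwi] := diff_neq0 _ _ zw; exists i; split=> //; exact/eqP.
apply: (@sub_finite_set _ _
  (\bigcup_(i in [set i | List.In i s]) [set l | diff_set (x l) (y l) i])).
  by move=> l /(Qs (x l, y l))[i [iD /eqP xyi]]; exists i.
apply: bigcup_finite => [|i _]; first exact: finite_In.
have [[l li]|nl] := pselect (exists l, diff_set (x l) (y l) i).
  by apply: (@sub_finite_set _ _ [set l]) => // l' l'i; apply: dxy l'i li.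
by rewrite (_ : [set l | _] = set0)//; apply/seteqP; split=> // l li; apply: nl; exists l.
Qed.

Definition heavy (U : set K) : Prop := exists x y : (nat -> bool) -> K,
  [/\ forall l, U (x l), forall l, x l <> y l &
    forall l l' i, diff_set (x l) (y l) i -> diff_set (x l') (y l') i -> l = l'].

Lemma heavy_sub (U V : set K) : U `<=` V -> heavy U -> heavy V.
Proof. by move=> UV [x [y [Ux xy d]]]; exists x, y; split=> // l; exact: UV. Qed.

(** The point [y] ranges over all of [K], so that the boxes over [J] form a neighbourhood base at
    [x]. *)
Definition separates (J : set I) (x : K) : Prop :=
  forall y, (forall i, J i -> phi x i = phi y i) -> x = y.

(* [J] is the union of the differences along a maximal family of pairs with
   disjoint differences. *)
Lemma light_separated (U : set K) : ~ heavy U ->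
  exists2 J, small J & forall x, U x -> separates J x.
Proof.
move=> lU; pose good (P : set (K * K)) :=
  (forall p, P p -> U p.1 /\ p.1 <> p.2) /\
  (forall p q i, P p -> P q -> diff_set p.1 p.2 i -> diff_set q.1 q.2 i -> p = q).
have [P [[PU Pd] Pmax]] : exists P, good P /\ forall P', P `<` P' -> ~ good P'.
  apply: (@Zorn_bigcup _ good) => F Fg Ft; split.
    by move=> p [P FP Pp]; have [PU _] := Fg _ FP; exact: PU.
  move=> p q i [P FP Pp] [Q FQ Qq].
  have [PQ|QP] := Ft _ _ FP FQ.
    by have [_ Qd] := Fg _ FQ; apply: Qd => //; exact: PQ.
  by have [_ Pd] := Fg _ FP; apply: Pd => //; exact: QP.
exists (\bigcup_(p in P) diff_set p.1 p.2).
  apply: small_bigcup_countable => [[f [fP finj]]|p _]; last exact: diff_countable.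
  apply: lU; exists (fun l => (f l).1), (fun l => (f l).2); split.
  - by move=> l; have [] := PU _ (fP l).
  - by move=> l; have [] := PU _ (fP l).
  - by move=> l l' i di di'; apply: finj; apply: Pd di di'.
move=> x Ux y xyJ; apply: contrapT => xy.
have dJ p i : P p -> diff_set p.1 p.2 i -> ~ diff_set x y i.
  by move=> Pp dp; apply; apply: xyJ; exists p.
apply: (Pmax (P `|` [set (x, y)])).
  split; first exact: subsetUl.
  move=> /(_ (x, y) (or_intror erefl)) Pxy.
  by have [i xyi] := diff_neq0 _ _ xy; exact: (dJ _ _ Pxy xyi).
split=> [p [/PU//|->]//|p q i [Pp|->] [Pq|->] dp dq //].
- exact: Pd dp dq.
- by case: (dJ _ _ Pp dp).
- by case: (dJ _ _ Pq dq).
Qed.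

(** Basic open sets are coded by lists of coordinates with rational intervals, whose number
    [small_lists] controls. *)
Definition box (s : seq (I * (rat * rat))) : set K :=
  [set z | forall t, List.In t s -> ratr t.2.1 < phi z t.1 < ratr t.2.2].

Lemma open_box s : open (box s).
Proof.
elim: s => [|t s IH].
  by rewrite (_ : box _ = setT); [exact: openT|apply/seteqP; split=> // z _ t []].
rewrite (_ : box _ = (fun z => phi z t.1) @^-1` `]ratr t.2.1, ratr t.2.2[ `&` box s).
  by apply: openI => //; apply: open_comp => [z _|]; [exact: phi_cont|exact: itv_open].
apply/seteqP; split=> [z zP|z [/= + zs] t' [<-|/zs//]].
  split=> [|t' t's]; last by apply: zP; right.
  by rewrite /= in_itv; apply: zP; left.
by rewrite in_itv.
Qed.

Definition boxes_over (J : set I) : set (seq (I * (rat * rat))) :=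
  [set s | forall t, List.In t s -> (J `*` setT) t].

Lemma small_boxes_over J : small J -> small (boxes_over J).
Proof.
move=> sJ; apply: small_lists; apply: small_setX => //.
exact/small_countable/countableP.
Qed.

(** Every point outside [O] is excluded by a closed rational strip around [x] in a coordinate from
    [J]; by compactness finitely many strips exclude them all. *)
Lemma separates_box J x (O : set K) : separates J x -> open O -> O x ->
  exists2 s, boxes_over J s & box s x /\ box s `<=` O.
Proof.
move=> sJ oO Ox.
pose D : set (I * (rat * rat)) :=
  [set t | J t.1 /\ ratr t.2.1 < phi x t.1 < ratr t.2.2].
pose V (t : I * (rat * rat)) :=
  [set z | ~~ (ratr t.2.1 <= phi z t.1 <= ratr t.2.2)].
have oV t : D t -> open (V t).
  move=> _; rewrite (_ : V t =
    ~` ((fun z => phi z t.1) @^-1` `[ratr t.2.1, ratr t.2.2]%classic)).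
    apply: closed_openC; apply: closed_comp => [z _|]; first exact: phi_cont.
    exact: itv_closed.
  by apply/funext => z; rewrite /V /= in_itv /=; apply/propext; split=> /negP.
have cO : compact (~` O).
  by apply: subclosed_compact cK _ => //; exact: open_closedC.
have [|s [sD Os]] := compact_subcover _ _ _ cO oV.
  move=> y /= nOy; have xy : x <> y by move=> xy; apply: nOy; rewrite -xy.
  have [i [Ji xyi]] : exists i, J i /\ phi x i <> phi y i.
    apply: contrapT => /forallNP ni; apply: xy; apply: sJ => i Ji.
    by apply: contrapT => xyi; apply: (ni i).
  (* One end of the interval is a rational strictly between the two coordinates; the other is any
     rational on the far side of [phi x i]. *)
  have [lt|gt|//] := ltgtP (phi x i) (phi y i).
    have [b] := rat_in_itvoo lt; rewrite in_itv /= => /andP[xb byi].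
    have [|a] := @rat_in_itvoo R (phi x i - 1) (phi x i); first by rewrite gtrBl.
    rewrite in_itv /= => /andP[_ ax].
    exists (i, (a, b)); split; first by split=> //=; rewrite ax.
    by rewrite /V /= negb_and -!ltNge byi orbT.
  have [a] := rat_in_itvoo gt; rewrite in_itv /= => /andP[ya ax].
  have [|b] := @rat_in_itvoo R (phi x i) (phi x i + 1); first by rewrite ltrDl.
  rewrite in_itv /= => /andP[xb _].
  exists (i, (a, b)); split; first by split=> //=; rewrite ax.
  by rewrite /V /= negb_and -!ltNge ya.
exists s; first by move=> t /sD[Jt _]; split.
split=> [t /sD[]//|z zs]; apply: contrapT => /Os[t [ts]].
by rewrite /V /=; have /andP[/ltW -> /ltW ->] := zs t ts.
Qed.

(** Choose a point in each box that meets [U]. A coordinate nonzero at a point of [U] is nonzero on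
    a whole box around it, hence at the chosen point of that box, and each chosen point has
    countable support. *)
Lemma small_supports (U : set K) J : open U -> small J ->
  (forall x, U x -> separates J x) -> small (\bigcup_(x in U) supp x).
Proof.
move=> oU sJ Jsep; have [[x0 Ux0]|nU] := pselect (exists x, U x); last first.
  apply: (@small_sub _ _ set0) => [i [x Ux _]|]; first by apply: nU; exists x.
  exact/small_countable/countable0.
have /choice[g gP] : forall s, exists z, (box s `&` U) !=set0 -> (box s `&` U) z.
  move=> s; have [[z zP]|ns] := pselect ((box s `&` U) !=set0); first by exists z.
  by exists x0.
apply: (@small_sub _ _ (\bigcup_(s in boxes_over J) supp (g s))).
  move=> i [x Ux xi].
  have [s sJ' [xs sU]] := separates_box J x _ (Jsep _ Ux)
    (openI oU (open_neq0 i)) (conj Ux xi).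
  exists s => //; have [gs _] : (box s `&` U) (g s) by apply: gP; exists x.
  by have [] := sU _ gs.
by apply: small_bigcup_countable => [|s _]; [exact: small_boxes_over|exact: phi_supp].
Qed.

Lemma small_weight J : small J -> (forall x, supp x `<=` J) -> small (weight K).
Proof.
move=> sJ suppJ; have [_ minw] := weightP K.
have Jsep x : separates J x.
  move=> y xyJ; apply: phi_inj => i; have [Ji|nJ] := pselect (J i); first exact: xyJ.
  have x0 : phi x i = 0.
    by apply/eqP/negPn/negP => /suppJ.
  have y0 : phi y i = 0 by apply/eqP/negPn/negP => /suppJ.
  by rewrite x0 y0.
have bB : basis (box @` boxes_over J).
  split=> [_ [s _ <-]|x A]; first exact: open_box.
  rewrite nbhsE => -[V [oV Vx] VA].
  have [s sJ' [xs sV]] := separates_box J x V (Jsep x) oV Vx.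
  exists (box s); last exact: subset_trans sV VA.
  by split=> //; exists s.
have wB := minw _ bB.
have [g [gB ginj]] := card_le_injfun set0 _ _ wB.
apply: (small_inj g _ _ gB ginj); apply: small_image; exact: small_boxes_over.
Qed.

End Corson.

(** * Heavy points and the dichotomy between a nontrivial extension and small weight *)

Section Corson_Ext.
Context {R : realType} {K : topologicalType} (cK : compact [set: K]).
Context {I : Type} (phi : K -> I -> R).
Hypothesis hK : hausdorff_space K.
Hypothesis phi_cont : forall i, continuous (fun z => phi z i).
Hypothesis phi_inj : forall x y, (forall i, phi x i = phi y i) -> x = y.
Hypothesis phi_supp : forall x, countable [set i | phi x i != 0].

Let diff_set := diff_set phi.
Let supp := supp phi.
Let heavy := heavy phi.

Definition heavy_points : set K :=
  [set x | forall U, open U -> U x -> heavy U].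

(** In shrinking neighbourhoods of [p], repeatedly separate [p] from another heavy point. This
    splits off pairwise disjoint heavy open sets, to which [Ext_disjoint_sequence] applies. *)
Lemma heavy_accumulation_Ext (p : K) :
  (forall V, open V -> V p -> exists a, [/\ V a, a <> p & heavy_points a]) ->
  Ext_neq0 (C_space R cK) (c0_space R).
Proof.
move=> acc.
have /choice[step stepP] : forall V : set K, exists UV : set K * set K,
    open V -> V p -> [/\ open UV.1, heavy UV.1, open UV.2, UV.2 p &
      UV.1 `<=` V /\ UV.2 `<=` V /\ UV.1 `&` UV.2 = set0].
  move=> V; have [[oV Vp]|nV] := pselect (open V /\ V p); last first.
    by exists (V, V) => oV Vp; exfalso; apply: nV.
  have [a [Va ap Ha]] := acc _ oV Vp.
  have := hK; rewrite open_hausdorff => /(_ a p).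
  have /eqP ap' := ap => /(_ ap')[[A B] /= [Aa Bp] [oA oB AB]].
  exists (A `&` V, B `&` V) => _ _; split=> /=.
  - exact: openI.
  - apply: Ha; first exact: openI.
    by split=> //; move: Aa; rewrite inE.
  - exact: openI.
  - by split=> //; move: Bp; rewrite inE.
  split; first by move=> z [].
  by split; [move=> z []|apply/seteqP; split=> // z [[Az _] [Bz _]]; rewrite -(eqP AB)].
pose V n := iter n (fun V => (step V).2) setT.
have VP n : open (V n) /\ V n p.
  elim: n => [|n [oV Vp]]; first by split=> //; exact: openT.
  by have [_ _ ? ? _] := stepP _ oV Vp.
pose U n := (step (V n)).1.
have UP n := stepP _ (VP n).1 (VP n).2.
have Vmono m n : (m <= n)%N -> V n `<=` V m.
  elim: n => [|n IH]; first by rewrite leqn0 => /eqP ->.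
  rewrite leq_eqVlt => /orP[/eqP -> //|mn].
  by apply: subset_trans (IH mn); have [_ _ _ _ [_ []]] := UP n.
have dU m n z : (m < n)%N -> U m z -> ~ U n z.
  move=> mn Um Un; have [_ _ _ _ [_ [_ UV0]]] := UP m.
  suff : set0 z by [].
  rewrite -UV0; split=> //; apply: (Vmono _ _ mn).
  by have [_ _ _ _ [UV _]] := UP n; exact: UV.
have /choice[x] : forall n, exists x, exists y : (nat -> bool) -> K,
  [/\ forall l, U n (x l), forall l, x l <> y l &
    forall l l' i, diff_set (x l) (y l) i -> diff_set (x l') (y l') i -> l = l'].
  by move=> n; have [_ [x [y xyP]] _ _ _] := UP n; exists x, y.
move=> /choice[y xyP].
apply: (@Ext_disjoint_sequence _ _ cK hK U x y).
- by move=> n; have [] := UP n.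
- move=> m n z Um Un; have [mn|nm|//] := ltngtP m n.
    by case: (dU _ _ _ mn Um).
  by case: (dU _ _ _ nm Un).
- by move=> n l; have [] := xyP n.
- by move=> n l; have [] := xyP n.
- move=> n; apply: (disjoint_diff_null cK phi phi_cont phi_inj).
  by have [] := xyP n.
Qed.

(** Since heavy points accumulate nowhere, each point has a neighbourhood with no heavy point other
    than itself, and compactness leaves finitely many of them. *)
Lemma heavy_points_countable : ~ Ext_neq0 (C_space R cK) (c0_space R) ->
  countable heavy_points.
Proof.
move=> nExt; apply: finite_set_countable.
have /choice[V VP] : forall p, exists V : set K, [/\ open V, V p &
    forall a, V a -> heavy_points a -> a = p].
  move=> p; apply: contrapT => /forallNP nV; apply: nExt.
  apply: (heavy_accumulation_Ext p) => V oV Vp.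
  apply: contrapT => /forallNP na; apply: (nV V); split=> // a Va Ha.
  by apply: contrapT => ap; apply: (na a).
have [p _|x _|s [_ sP]] := compact_subcover _ setT V cK.
- by have [] := VP p.
- by exists x; split=> //; have [] := VP x.
apply: sub_finite_set (finite_In s) => a Ha; have [p [ps Va]] := sP a Logic.I.
by have [_ _ /(_ _ Va Ha) ->] := VP p.
Qed.

Lemma Corson_Ext_or_small :
  Ext_neq0 (C_space R cK) (c0_space R) \/ small (weight K).
Proof.
have [|nExt] := pselect (Ext_neq0 (C_space R cK) (c0_space R)); first by left.
right; pose light U := ~ heavy U.
pose good (Q : set (K * K * set K)) :=
  (forall t, Q t -> [/\ open t.2, light t.2, t.2 t.1.1 & t.1.1 <> t.1.2]) /\
  (forall s t, Q s -> Q t ->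
    (exists i, diff_set s.1.1 s.1.2 i /\ diff_set t.1.1 t.1.2 i) \/
    (exists z, s.2 z /\ t.2 z) -> s = t).
have [Q [[QP Qd] Qmax]] : exists Q, good Q /\ forall Q', Q `<` Q' -> ~ good Q'.
  apply: (@Zorn_bigcup _ good) => F Fg Ft; split.
    by move=> t [Q FQ Qt]; have [QP _] := Fg _ FQ; exact: QP.
  move=> s t [P FP Ps] [Q FQ Qt].
  have [PQ|QP] := Ft _ _ FP FQ.
    by have [_ Qd] := Fg _ FQ; apply: Qd => //; exact: PQ.
  by have [_ Pd] := Fg _ FP; apply: Pd => //; exact: QP.
have cQ : countable Q.
  apply: contrapT => /uncountable_index[L [c [t [cinj tinj tQ uncL]]]].
  apply: nExt; apply: (@Ext_uncountable_disjoint _ _ cK hK L c (fun l => (t l).2)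
    (fun l => (t l).1.1) (fun l => (t l).1.2)) => //.
  - by move=> l; have [] := QP _ (tQ l).
  - move=> l l' z tl tl'; apply: tinj; apply: Qd => //.
    by right; exists z.
  - by move=> l; have [] := QP _ (tQ l).
  - by move=> l; have [] := QP _ (tQ l).
  apply: (disjoint_diff_null cK phi phi_cont phi_inj) => l l' i di di'.
  by apply: tinj; apply: Qd => //; left; exists i.
pose J := \bigcup_(t in Q) diff_set t.1.1 t.1.2.
have sJ : small J.
  apply: small_countable; apply: bigcup_countable => // t _.
  exact: diff_countable.
pose V := \bigcup_(t in Q) t.2.
(* [U] consists of the points off the closure of [V] with a light neighbourhood. If [J] failed to
   separate one of them from some [y], the pair could be added to [Q]. *)
pose U := ~` closure V `&` \bigcup_(W in [set W | open W /\ light W]) W.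
have oU : open U.
  apply: openI; first by apply: closed_openC; exact: closed_closure.
  by apply: bigcup_open => W [].
have Usep x : U x -> separates phi J x.
  move=> [nVx [W [oW lW] Wx]] y xyJ; apply: contrapT => xy.
  have dJ t i : Q t -> diff_set t.1.1 t.1.2 i -> ~ diff_set x y i.
    by move=> Qt dt; apply; apply: xyJ; exists t.
  pose W' := W `&` ~` closure V.
  have W'V z t : Q t -> W' z -> ~ t.2 z.
    by move=> Qt [_ nVz] tz; apply: nVz; apply: subset_closure; exists t.
  have W'x : W' x by split.
  apply: (Qmax (Q `|` [set (x, y, W')])).
    split; first exact: subsetUl.
    move=> /(_ (x, y, W') (or_intror erefl)) Qxy.
    exact: (W'V _ _ Qxy W'x W'x).
  split=> [t [/QP//|->]|s t [Qs|->] [Qt|->]//].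
  - split=> //=; first by apply: openI => //; apply: closed_openC; exact: closed_closure.
    by move=> hW'; apply: lW; apply: heavy_sub hW' => z [].
  - exact: Qd.
  - move=> [[i [di dxy]]|[z [sz W'z]]]; first by case: (dJ _ _ Qs di).
    by case: (W'V _ _ Qs W'z).
  - move=> [[i [dxy di]]|[z [W'z tz]]]; first by case: (dJ _ _ Qt di).
    by case: (W'V _ _ Qt W'z).
(* [S] takes the supports over [U], over the light sets of [Q], and over the heavy points. The
   boundary of [V] adds nothing, as a coordinate nonzero at a point of the closure is nonzero
   somewhere in [V]. *)
pose S := (\bigcup_(x in U) supp x `|`
  \bigcup_(t in Q) \bigcup_(x in t.2) supp x) `|` \bigcup_(x in heavy_points) supp x.
apply: (small_weight cK phi phi_cont phi_inj S).
  apply: smallU; first apply: smallU.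
  - exact: (small_supports cK phi phi_cont phi_supp U J).
  - apply: small_bigcup_index => // t Qt; have [ot lt _ _] := QP _ Qt.
    have [Jt sJt Jtsep] := light_separated phi phi_inj phi_supp _ lt.
    exact: (small_supports cK phi phi_cont phi_supp _ Jt).
  apply: small_countable; apply: bigcup_countable => [|x _]; last exact: phi_supp.
  exact: heavy_points_countable.
move=> x i xi; have [Hx|nHx] := pselect (heavy_points x); first by right; exists x.
left; have [Vx|nVx] := pselect (closure V x).
  right; have [|z [[t Qt tz] zi]] := Vx [set z | phi z i != 0].
    by apply: open_nbhs_nbhs; split=> //; exact: open_neq0.
  by exists t => //; exists z.
left; exists x => //; split=> //; apply: contrapT => nW; apply: nHx => W oW Wx.
by apply: contrapT => lW; apply: nW; exists W.
Qed.

End Corson_Ext.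

(** * The continuum hypothesis and metrizability *)

(** Digits 0 and 1 are read in base 3: all places after [k] contribute at most half of [3 ^- k], so
    the first differing digit decides the order. *)
Lemma cantor_injection (R : realType) :
  exists f : (nat -> bool) -> R, injective f.
Proof.
pose a (l : nat -> bool) n : R := \sum_(i < n) (l i)%:R * 3%:R ^- i.
have p3 n : 0 < 3%:R ^- n :> R by rewrite invr_gt0 exprn_gt0.
have aS l n : a l n.+1 = a l n + (l n)%:R * 3%:R ^- n by rewrite /a big_ord_recr.
(* The added term is the exact geometric sum over the places from [k] to [k + n - 1], which makes
   the induction close. *)
have a_le l k n : a l (k + n)%N <= a l k + 3 / 2 * 3%:R ^- k * (1 - 3%:R ^- n).
  elim: n => [|n IH]; first by rewrite addn0 expr0 invr1 subrr mulr0 addr0.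
  rewrite addnS aS (_ : 3%:R ^- n.+1 = 3%:R ^- n / 3); last first.
    by rewrite exprSr invfM.
  have : (l (k + n)%N)%:R * 3%:R ^- (k + n)%N <= 3%:R ^- k * 3%:R ^- n :> R.
    by rewrite exprD invfM; case: (l _); rewrite ?mul1r// mul0r mulr_ge0 ?ltW.
  move: IH (p3 n) (p3 k); move: (3%:R ^- n) (3%:R ^- k) => u v; nra.
have a_mono l m n : (m <= n)%N -> a l m <= a l n.
  elim: n => [|n IH]; first by rewrite leqn0 => /eqP ->.
  rewrite leq_eqVlt => /orP[/eqP -> //|/IH /le_trans]; apply.
  by rewrite aS lerDl mulr_ge0// ltW.
have a_bd l k n : a l n <= a l k + 3 / 2 * 3%:R ^- k.
  have [nk|/ltnW kn] := leqP n k.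
    by rewrite (le_trans (a_mono l _ _ nk))// lerDl mulr_ge0// ltW.
  have := a_le l k (n - k)%N; rewrite subnKC// => /le_trans; apply.
  by rewrite lerD2l ler_piMr ?mulr_ge0 ?ltW// gtrBl.
pose f l := sup (range (a l)).
have ubd l : has_ubound (range (a l)).
  by exists (a l 0%N + 3 / 2 * 3%:R ^- 0) => _ [n _ <-].
have f_lt l m k : (forall i, (i < k)%N -> l i = m i) -> l k = false -> m k = true ->
    f l < f m.
  move=> lm lk mk.
  have ak : a l k = a m k by apply: eq_bigr => i _; rewrite lm.
  apply: (@le_lt_trans _ _ (a l k.+1 + 3 / 2 * 3%:R ^- k.+1)).
    apply: ge_sup; first by exists (a l 0%N), 0%N.
    by move=> _ [n _ <-].
  apply: (@lt_le_trans _ _ (a m k.+1)); last by apply: ub_le_sup => //; exists k.+1.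
  rewrite !aS lk mk mul0r mul1r addr0 ak ltrD2l exprSr invfM.
  have := p3 k; lra.
exists f => l m flm; apply: contrapT => lm.
have ex : exists k, l k != m k.
  by apply: contrapT => /forallNP nk; apply: lm; apply/funext => k;
    apply/eqP/negPn/negP; exact: nk.
have [k lmk kmin] := ex_minnP ex.
have lmi i : (i < k)%N -> l i = m i.
  by move=> ik; apply/eqP/negPn/negP => /kmin; rewrite leqNgt ik.
case lk : (l k) lmk; case mk : (m k) => // _.
  by have := f_lt m l k (fun i ik => esym (lmi i ik)) mk lk; rewrite flm ltxx.
by have := f_lt l m k lmi lk mk; rewrite flm ltxx.
Qed.

(** * Metrizability from a separating sequence of continuous functions *)

Section separating_sequence.
Context {R : realType} {K : topologicalType} (psi : nat -> K -> R).
Hypothesis psi_sep : forall x y, (forall n, psi n x = psi n y) -> x = y.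

Let term x y n : R := Num.min (2%:R ^- n) `|psi n x - psi n y|.

Let term_ub x y : has_ubound (range (term x y)).
Proof.
exists 1 => _ [n _ <-]; rewrite ge_min invf_le1 ?exprn_gt0//.
by rewrite exprn_ege1 ?ler1n.
Qed.

Let term_ge0 x y n : 0 <= term x y n.
Proof. by rewrite le_min invr_ge0 exprn_ge0 ?normr_ge0. Qed.

Definition seq_dist x y : R := sup (range (term x y)).

Lemma seq_dist_ge x y n : term x y n <= seq_dist x y.
Proof. by apply: (ub_le_sup (term_ub x y)); exists n. Qed.

Lemma seq_dist_le x y M : (forall n, term x y n <= M) -> seq_dist x y <= M.
Proof. by move=> h; apply: ge_sup => [|_ [n _ <-]//]; exists (term x y 0%N), 0%N. Qed.

Lemma seq_distxx x : seq_dist x x = 0.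
Proof.
apply/eqP; rewrite eq_le (le_trans (term_ge0 x x 0) (seq_dist_ge _ _ _)) andbT.
by apply: seq_dist_le => n; rewrite /term subrr normr0 ge_min lexx orbT.
Qed.

Lemma seq_dist_eq0 x y : seq_dist x y = 0 -> x = y.
Proof.
move=> d0; apply: psi_sep => n; apply/eqP; rewrite -subr_eq0 -normr_le0.
have := seq_dist_ge x y n; rewrite d0 ge_min => /orP[|//].
by rewrite leNgt invr_gt0 exprn_gt0.
Qed.

Lemma seq_dist_sym x y : seq_dist x y = seq_dist y x.
Proof.
rewrite /seq_dist; suff -> : term x y = term y x by [].
by apply/funext => n; rewrite /term distrC.
Qed.

Lemma seq_dist_triangle y x z : seq_dist x z <= seq_dist x y + seq_dist y z.
Proof.
apply: seq_dist_le => n.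
rewrite (le_trans _ (lerD (seq_dist_ge x y n) (seq_dist_ge y z n)))//.
have B0 := term_ge0 x y n; have C0 := term_ge0 y z n; move: B0 C0.
have := ler_distD (psi n y) (psi n x) (psi n z); rewrite /term.
move: (2%:R ^- n) `|psi n x - psi n z| `|psi n x - psi n y| `|psi n y - psi n z|.
move=> c A B C AB; have [cB|Bc] := leP c B; have [cC|Cc] := leP c C => B0 C0.
- by rewrite ge_min lerDl C0.
- by rewrite ge_min lerDl C0.
- by rewrite ge_min lerDr B0.
- by rewrite ge_min AB orbT.
Qed.

(** A copy of [K] carries the metric topology beside the original one. Mentioning [psi_sep] makes
    the type depend on the proof from which its metric structure is built. *)
Definition seq_metric : Type := let _ := psi_sep in K.

HB.instance Definition _ := Choice.on seq_metric.
HB.instance Definition _ := isMetric.Build R seq_metric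
  seq_distxx seq_dist_eq0 seq_dist_sym seq_dist_triangle.

(** Terms of index at least [N] are truncated below [e / 2], so continuity is used for the first [N]
    functions only. *)
Lemma seq_metric_cvg (x : K) : (forall n, continuous (psi n)) ->
  (id : K -> seq_metric) @ x --> (x : seq_metric).
Proof.
move=> psi_cont; apply/cvg_ballP => e e0.
pose N := Num.bound (2 / e).
have Ne : 2%:R ^- N < e / 2.
  have : 2 / e < N%:R by apply: archi_boundP; rewrite divr_ge0// ltW.
  have N0 : (N%:R : R) <= 2%:R ^+ N by rewrite -natrX ler_nat ltnW// ltn_expl.
  move=> /lt_le_trans/(_ N0) h.
  by rewrite -[e / 2]invrK ltf_pV2 ?posrE ?invr_gt0 ?exprn_gt0 ?divr_gt0// invf_div.
have e20 : 0 < e / 2 by rewrite divr_gt0.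
have : \forall y \near x, forall n, `I_N n -> `|psi n x - psi n y| <= e / 2.
  apply: near_finite_set => // n _.
  by have /cvgrPdist_le/(_ _ e20) := psi_cont n x.
apply: filterS => y xy; rewrite ballEmdist /=.
apply: (@le_lt_trans _ _ (e / 2)); last by rewrite ltr_pdivrMr// mulr_natr mulr2n ltrDl.
apply: seq_dist_le => n; rewrite /term ge_min; have [nN|Nn] := ltnP n N.
  by rewrite xy ?orbT.
by rewrite (le_trans _ (ltW Ne))// lef_pV2 ?posrE ?exprn_gt0// ler_weXn2l// ler1n.
Qed.

(** A continuous bijection from a compact space onto a Hausdorff space is closed. *)
Lemma seq_metrizable : compact [set: K] -> (forall n, continuous (psi n)) ->
  metrizable R K.
Proof.
move=> cK psi_cont.
have cf : continuous (id : K -> seq_metric) by move=> x; exact: seq_metric_cvg.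
exists seq_metric, id, id; split=> //; apply/continuousP => A oA.
rewrite preimage_id -[A]setCK; apply: closed_openC.
apply: compact_closed; first exact: metric_hausdorff.
rewrite -[~` A](image_id); apply: (@continuous_compact K seq_metric).
  exact: continuous_subspaceT.
by apply: subclosed_compact cK _ => //; exact: open_closedC.
Qed.

End separating_sequence.

Section Corson_weight.
Context {R : realType} {K : topologicalType}.
Context {I : Type} (phi : K -> I -> R).
Hypothesis phi_cont : forall i, continuous (fun z => phi z i).
Hypothesis phi_inj : forall x y, (forall i, phi x i = phi y i) -> x = y.
Hypothesis phi_supp : forall x, countable [set i | phi x i != 0].

(** Choose a point in each member of a countable base. A coordinate that is somewhere nonzero is
    nonzero on a member of the base, hence at its chosen point; so countably many coordinates
    separate the points of [K]. *)
Lemma countable_weight_metrizable : compact [set: K] ->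
  countable (weight K) -> metrizable R K.
Proof.
move=> cK cw; have [[openw basw] _] := weightP K.
have [[x0 _]|K0] := pselect ([set: K] !=set0); last first.
  apply: (@seq_metrizable R K (fun _ _ => 0)) => // [x|n x]; last exact: cvg_cst.
  by exfalso; apply: K0; exists x.
have /choice[g gP] : forall W : set K, exists z, W !=set0 -> W z.
  by move=> W; have [[z Wz]|] := pselect (W !=set0); [exists z|exists x0].
pose J := \bigcup_(W in weight K) [set i | phi (g W) i != 0].
have cJ : countable J by apply: bigcup_countable => // W _; exact: phi_supp.
have JP x i : phi x i != 0 -> J i.
  move=> xi; have [W [wW Wx] WO] : filter_from [set U | weight K U /\ U x] id
      [set z | phi z i != 0].
    by apply: basw; apply: open_nbhs_nbhs; split=> //; exact: open_neq0.
  by exists W => //; apply: WO; apply: gP; exists x.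
have /countable_injP[e einj] := cJ.
(* The coordinates in [J] are listed along [e], with the zero function at integers that [e]
   misses. *)
have /choice[psi psiP] : forall n, exists p : K -> R,
    continuous p /\ forall i, J i -> e i = n -> p = phi ^~ i.
  move=> n; have [[i [Ji ei]]|ni] := pselect (exists i, J i /\ e i = n).
    exists (phi ^~ i); split=> // j Jj ej; suff -> : i = j by [].
    by apply: einj; rewrite ?inE// ei ej.
  exists (fun=> 0); split=> [x|i Ji ei]; first exact: cvg_cst.
  by exfalso; apply: ni; exists i.
apply: (@seq_metrizable R K psi) => // [x y xy|n]; last by have [] := psiP n.
apply: phi_inj => i; have [Ji|nJ] := pselect (J i).
  by have := xy (e i); have [_ /(_ i Ji erefl) ->] := psiP (e i).
have z0 z : phi z i = 0 by apply/eqP/negPn/negP => /JP.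
by rewrite !z0.
Qed.

End Corson_weight.

Lemma continuum_le_not_small {R : realType} {T : Type} (A : set T) :
  [set: R] #<= A -> ~ small A.
Proof.
move=> RA; have [f finj] := cantor_injection R.
have [a0 _] : A !=set0.
  apply/set0P/eqP => A0; move: RA; rewrite A0 card_le0 => /eqP R0.
  by have : [set: R] 0 by []; rewrite R0.
have [g [gA ginj]] := card_le_injfun a0 _ _ RA.
apply; exists (g \o f); split=> [l|l m /= /ginj fE]; first exact: gA.
by apply: finj; exact: fE.
Qed.

Lemma continuum_hypothesis_le {R : realType} {T : Type} (A : set T) :
  continuum_hypothesis R -> ~ countable A -> [set: R] #<= A.
Proof.
move=> CH ncA; have [|AR] := card_le_total [set: R] A; first by [].
have [g [_ ginj]] := card_le_injfun (0 : R) _ _ AR.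
have /card_esym gA : g @` A #= A.
  by apply: inj_card_eq => x y; rewrite !inE; exact: ginj.
have [cg|gR] := CH (g @` A); first by exfalso; apply: ncA; rewrite (eq_countable gA).
have := card_eq_trans gA gR; rewrite card_eq_le => /andP[_]; exact.
Qed.

Lemma ptws_eval_continuous {I : Type} {T : topologicalType} (i : I) :
  continuous (fun h : {ptws I -> T} => h i).
Proof.
move=> h; have /cvg_sup/(_ i) hi : nbhs (h : {ptws I -> T}) --> (h : {ptws I -> T}).
  exact: cvg_id.
by apply: (cvg_trans _ (@initial_continuous _ _ (fun h : I -> T => h i) h)); apply: cvg_app.
Qed.

Theorem theorem3p1 (R : realType) (K : topologicalType)
    (cK : compact [set: K]) (hK : Corson_compact R K) :
  ([set: R] #<= weight K -> Ext_neq0 (C_space R cK) (c0_space R)) /\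
  (continuum_hypothesis R -> ~ metrizable R K ->
    Ext_neq0 (C_space R cK) (c0_space R)).
Proof.
have [_ hausK [I [phi [phi_cont phi_inj phi_Sigma]]]] := hK.
have phi_coord (i : I) : continuous (fun z => (phi z : I -> R) i).
  move=> z; apply: (cvg_comp phi (fun h : {ptws I -> R} => h i) (phi_cont z)).
  exact: ptws_eval_continuous.
have phi_sep x y : (forall i, phi x i = phi y i) -> x = y.
  by move=> xy; apply: phi_inj; apply/funext.
have phi_supp x : countable [set i | phi x i != 0].
  by apply: phi_Sigma; exists x.
have Ext_big : [set: R] #<= weight K -> Ext_neq0 (C_space R cK) (c0_space R).
  move=> /continuum_le_not_small nsw.
  by have [|/nsw] := Corson_Ext_or_small cK (phi : K -> I -> R) hausK phi_coord
    phi_sep phi_supp.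
split=> // CH nm; apply: Ext_big; apply: continuum_hypothesis_le => // cw; apply: nm.
exact: (countable_weight_metrizable (phi : K -> I -> R)).
Qed.
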